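(* Fix nonnegative rationals $\varepsilon,\delta$ with $\delta<2$, and nonnegative integers $M$, $N\ge1$, such that $\nu\varepsilon-(N-k)\delta+2\ne0$ for all $0\le\nu\le M$, $0\le k\le N-1$. For $b=(b',b'')=(b'_0,\dots,b'_M,b''_0,\dots,b''_N)\in\mathbb{C}^{M+N+2}$ with $b'\ne0$, let $P(b;Z)=\sum_\mu b'_\mu Z^\mu$, $Q(b;Z)=\sum_\nu b''_\nu Z^\nu$. Then there exist an ARP $T(B',B'')\in\mathbb{Z}|(B',B'')|$ and $s_1\in(0,1)$ such that for every such $b$ with $|||Q(b;Z)-Z^N|||<s_1$ and $Q(b;Z)$ having only simple roots, $b$ lies in the strict domain of $T$ and $$\int_B\frac{|P(b;z)|^\varepsilon}{|Q(b;z)|^\delta}\,dV\sim T(b),$$ with implied constants independent of $b$, where $B$ is the unit disk.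
   Context: An ARP in variables $X$ with integer coefficients is an expression $K(X)/L(X)$ with $K=(\sum_i|P_i(X)|^2)^{\varepsilon'/2}$, $L=(\sum_j|Q_j(X)|^2)^{\delta'/2}$, finitely many $P_i,Q_j\in\mathbb{Z}[X]$, not all $P_i$ zero, $\varepsilon',\delta'$ nonnegative rationals; its strict domain is where neither $K$ nor $L$ vanishes. For $Q(Z)=\sum_\mu b_\mu Z^\mu$, $|||Q|||=\sum_\mu|b_\mu|$. $dV$ is Lebesgue measure on $\mathbb{C}$; $\sim$ means two-sided bounds up to positive constants. *)

(* Defs.v *)
From HB Require Import structures.
From mathcomp Require Import all_boot all_order all_algebra.
From mathcomp Require Import all_classical all_reals all_analysis.
From mathcomp Require Import complex.

Set Implicit Arguments.
Unset Strict Implicit.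
Unset Printing Implicit Defensive.

Import Order.TTheory GRing.Theory Num.Theory.
Import numFieldNormedType.Exports.
Local Open Scope ring_scope.
Local Open Scope complex_scope.

(* A polynomial in [n] (complex) variables with integer coefficients, given
   as a finite list of terms (coefficient, exponent vector). *)
Definition intpoly (n : nat) := seq (int * (n.-tuple nat)).

Definition ipeval (R : rcfType) (n : nat) (p : intpoly n) (x : 'I_n -> R[i])
  : R[i] :=
  \sum_(t <- p) (t.1%:~R * \prod_(i < n) x i ^+ tnth t.2 i).

Definition ipcoef (n : nat) (p : intpoly n) (e : n.-tuple nat) : int :=
  \sum_(t <- p | t.2 == e) t.1.

Definition ip_is_zero (n : nat) (p : intpoly n) : bool :=
  all (fun t => ipcoef p t.2 == 0) p.

(* An ARP  K(X)/L(X), K = (sum_i |P_i|^2)^(eps'/2), L = (sum_j |Q_j|^2)^(delta'/2). *)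
Record ARP (n : nat) := MkARP {
  arp_P : seq (intpoly n);
  arp_Q : seq (intpoly n);
  arp_eps : rat;
  arp_delta : rat;
  arp_eps_ge0 : (0 <= arp_eps)%R;
  arp_delta_ge0 : (0 <= arp_delta)%R;
  arp_P_nz : exists2 p, p \in arp_P & ~~ ip_is_zero p
}.

Section ARPeval.
Variable R : realType.
Variable n : nat.

Definition arp_K (T : ARP n) (x : 'I_n -> R[i]) : R :=
  powR (\sum_(p <- arp_P T) Normc.normc (ipeval p x) ^+ 2)
       (ratr (arp_eps T) / 2).

Definition arp_L (T : ARP n) (x : 'I_n -> R[i]) : R :=
  powR (\sum_(q <- arp_Q T) Normc.normc (ipeval q x) ^+ 2)
       (ratr (arp_delta T) / 2).

Definition arp_eval (T : ARP n) (x : 'I_n -> R[i]) : R :=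
  arp_K T x / arp_L T x.

Definition arp_strict_dom (T : ARP n) (x : 'I_n -> R[i]) : Prop :=
  arp_K T x != 0 /\ arp_L T x != 0.
End ARPeval.

Definition tnorm (R : rcfType) (p : {poly R[i]}) : R :=
  \sum_(i < size p) Normc.normc p`_i.

Definition simple_roots (R : rcfType) (p : {poly R[i]}) : Prop :=
  forall z : R[i], root p z -> mup z p = 1%N.

Definition bcat (T : Type) (m k : nat) (b1 : 'I_m -> T) (b2 : 'I_k -> T)
  : 'I_(m + k) -> T :=
  fun i => match fintype.split i with inl j => b1 j | inr j => b2 j end.

Definition coefpoly (R : rcfType) (m : nat) (b : 'I_m -> R[i]) : {poly R[i]} :=
  \poly_(i < m) (if (i < m)%N =P true is ReflectT h then b (Ordinal h) else 0).

Definition unit_disk (R : realType) : set (R * R) :=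
  [set p | p.1 ^+ 2 + p.2 ^+ 2 < 1].

Definition lebC (R : realType) :=
  ((@lebesgue_measure R) \x (@lebesgue_measure R))%E.

Definition cplx (R : realType) (p : R * R) : R[i] := p.1 +i* p.2.

(* Main.v *)
From HB Require Import structures.
From mathcomp Require Import all_boot all_order all_fingroup all_algebra.
From mathcomp Require mpoly.

Set Implicit Arguments.
Unset Strict Implicit.
Unset Printing Implicit Defensive.

Import Order.TTheory GRing.Theory Num.Theory.
Local Open Scope ring_scope.

(* Let [a_1, ..., a_N] be the roots of [Q].  For [z] closest to [a_i] and
   [r = |z - a_i|], the modulus of [Q z] is comparable to
   [\prod_j max r |a_i - a_j|], while the mean size of [P] at distance [r] from
   [a_i] is [\sum_nu |P^`N(nu)(a_i)| r^nu].  Between two consecutive distances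
   [|a_i - a_j|] the resulting radial weight is a sum of powers [r^sg], and
   [sg != -2] makes the integral of each power over an annulus comparable to its
   value at one of the two boundary scales.  Hence the integral is comparable to
   the sum over [i] and the scales [s = |a_i - a_l|] and [s = 2] of
     [(\sum_nu |P^`N(nu)(a_i)| s^nu)^eps s^2 / (\prod_j (s + |a_i - a_j|))^delta].
   A suitable power of that sum is a quotient of two sums of moduli of integer
   polynomials in the coefficients of [P] and the roots.  A sum of moduli
   [\sum |w|] is comparable to [(\sum_k |e_k(w)|^(2 n!/k))^(1/(2 n!))] by Cauchy's
   bound, and once the family is symmetrized over ['S_N] the elementary symmetric
   functions [e_k] are polynomials in the coefficients of [Q]. *)

(** * Symmetrized families of integer polynomials *)

(** With [k] roots within distance [r] of [a_i], the radial exponent is [nu eps - k delta], where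
    [1 <= k <= N]; the hypothesis keeps exactly these away from [-2], where a logarithm would
    appear. In the innermost range [a_i] is the only close root and no smaller scale exists; there
    [delta < 2] puts the exponent above [-2], so that the outer scale decides. Radial powers are
    integrated without polar coordinates: a geometric series of indicators of concentric squares
    dominates each of them.

    The obstacle is that the estimate is a quotient in the roots. It is kept in the multiplied-out
    form [numerator ~ I ^ m * denominator]; as the integral [I] ignores the ordering of the roots,
    summing over all orderings symmetrizes both sides separately.

    As [Q] need not be monic, symmetric functions give polynomials in its normalized coefficients;
    powers of the leading coefficient, which stays near 1, clear the denominators. The threshold
    [(1 / 4) ^ N] confines the roots to radius [1 / 4], so that test boxes at scales up to 2 stay in
    the unit disk. *)

(* [PB] stands for the coefficients of [P], [PA] for the roots (later: the
   normalized coefficients) of [Q]. *)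
Inductive pexp (m n : nat) :=
  | PInt of int
  | PB of 'I_m
  | PA of 'I_n
  | PAdd of pexp m n & pexp m n
  | PMul of pexp m n & pexp m n.

Arguments PInt {m n}.
Arguments PB {m n}.
Arguments PA {m n}.

Fixpoint peval (C : comNzRingType) (m n : nat) (b : 'I_m -> C) (a : 'I_n -> C)
    (e : pexp m n) : C :=
  match e with
  | PInt c => c%:~R
  | PB i => b i
  | PA j => a j
  | PAdd e1 e2 => peval b a e1 + peval b a e2
  | PMul e1 e2 => peval b a e1 * peval b a e2
  end.

Lemma eq_peval (C : comNzRingType) m n (b b' : 'I_m -> C) (a a' : 'I_n -> C) e :
  b =1 b' -> a =1 a' -> peval b a e = peval b' a' e.
Proof. by move=> eb ea; elim: e => //= [e1 -> e2 ->|e1 -> e2 ->]. Qed.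

Lemma rmorph_peval (C D : comNzRingType) (f : {rmorphism C -> D}) m n
    (b : 'I_m -> C) (a : 'I_n -> C) e :
  f (peval b a e) = peval (f \o b) (f \o a) e.
Proof.
elim: e => //= [c|e1 IH1 e2 IH2|e1 IH1 e2 IH2]; first exact: rmorph_int.
- by rewrite rmorphD IH1 IH2.
- by rewrite rmorphM IH1 IH2.
Qed.

Section Symmetrization.
Import mpoly.
Variables m n : nat.
Notation A := {mpoly {mpoly int[m]}[n]}.

(** The roots are the outer variables and the coefficients of [P] belong to the base ring, so that
    ['S_n] permutes the roots alone and the fundamental theorem on symmetric polynomials applies
    over [{mpoly int[m]}]. *)
Definition mev (C : comNzRingType) (b : 'I_m -> C) (a : 'I_n -> C) : A -> C :=
  mmap (mmap intr b) a.

HB.instance Definition _ (C : comNzRingType) (b : 'I_m -> C) (a : 'I_n -> C) :=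
  GRing.RMorphism.copy (mev b a) (mmap (mmap intr b) a).

Let Bv (i : 'I_m) : A := ('X_i)%:MP.
Let Xv (j : 'I_n) : A := 'X_j.

Lemma mev_Bv (C : comNzRingType) (b : 'I_m -> C) (a : 'I_n -> C) i :
  mev b a (Bv i) = b i.
Proof. by rewrite /mev /Bv mmapC /= mmapX mmap1U. Qed.

Lemma mev_Xv (C : comNzRingType) (b : 'I_m -> C) (a : 'I_n -> C) i :
  mev b a (Xv i) = a i.
Proof. by rewrite /mev /Xv mmapX mmap1U. Qed.

Lemma msym_peval (s : 'S_n) (t : 'I_n -> 'I_n) e :
  msym s (peval Bv (Xv \o t) e) = peval Bv (Xv \o (s \o t)) e.
Proof.
rewrite rmorph_peval; apply: eq_peval => i /=.
  by rewrite /Bv /msym mmapC.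
by rewrite /Xv /msym mmapX mmap1U.
Qed.

(** The way back from polynomials to expressions: [e] stands for the composite of [t] with [y]. The
    quantifier over rings makes one [e] serve all of them. *)
Definition sub_pexp (y : 'I_n -> pexp m n) (t : A) (e : pexp m n) :=
  forall (C : comNzRingType) (b : 'I_m -> C) (c : 'I_n -> C),
    mev b (fun i => peval b c (y i)) t = peval b c e.

Lemma sub_pexpX y i : sub_pexp y 'X_i (y i).
Proof. by move=> C b c; rewrite -[X in mev _ _ X]/(Xv i) mev_Xv. Qed.

Lemma sub_pexp_prod (I : Type) (r : seq I) (F : I -> A) y :
  (forall i, exists e, sub_pexp y (F i) e) ->
  exists e, sub_pexp y (\prod_(i <- r) F i) e.
Proof.
move=> h; elim: r => [|i r [e2 he2]].
  by exists (PInt 1) => C b c; rewrite big_nil rmorph1.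
have [e1 he1] := h i; exists (PMul e1 e2) => C b c.
by rewrite big_cons rmorphM /= he1 he2.
Qed.

Lemma sub_pexp_sum (I : Type) (r : seq I) (F : I -> A) y :
  (forall i, exists e, sub_pexp y (F i) e) ->
  exists e, sub_pexp y (\sum_(i <- r) F i) e.
Proof.
move=> h; elim: r => [|i r [e2 he2]].
  by exists (PInt 0) => C b c; rewrite big_nil rmorph0.
have [e1 he1] := h i; exists (PAdd e1 e2) => C b c.
by rewrite big_cons rmorphD /= he1 he2.
Qed.

Lemma sub_pexpC y (q : {mpoly int[m]}) : exists e, sub_pexp y q%:MP e.
Proof.
pose f : {rmorphism {mpoly int[m]} -> A} := mpolyC n (R := {mpoly int[m]}).
rewrite -[q%:MP]/(f q) [q]mpolyE rmorph_sum; apply: sub_pexp_sum => k.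
rewrite -mul_mpolyC rmorphM /= mpolyXE_id rmorph_prod.
have [|e1 he1] := @sub_pexp_prod _ (index_enum 'I_m) (fun i => f ('X_i ^+ k i)) y.
  move=> i; rewrite rmorphXn /=; elim: (k i) => [|j [e he]].
    by exists (PInt 1) => C b c; rewrite expr0 rmorph1.
  exists (PMul (PB i) e) => C b c; rewrite exprS rmorphM /= he.
  by rewrite -[X in mev _ _ X]/(Bv i) mev_Bv.
exists (PMul (PInt q@_k) e1) => C b c.
rewrite rmorphM /= he1 /=; congr (_ * _).
by rewrite /f /mev /= mmapC /= mmapC.
Qed.

Lemma sub_pexp_ex y (t : A) : exists e, sub_pexp y t e.
Proof.
rewrite [t]mpolyE; apply: sub_pexp_sum => k.
rewrite -mul_mpolyC mpolyXE_id.
have [e1 he1] := sub_pexpC y t@_k.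
have [|e2 he2] := @sub_pexp_prod _ (index_enum 'I_n) (fun i => 'X_i ^+ k i) y.
  move=> i; elim: (k i) => [|j [e he]].
    by exists (PInt 1) => C b c; rewrite expr0 rmorph1.
  exists (PMul (y i) e) => C b c; rewrite exprS rmorphM /= he.
  by rewrite sub_pexpX.
exists (PMul e1 e2) => C b c; rewrite rmorphM; congr (_ * _); [exact: he1|exact: he2].
Qed.

(** Vieta's formula; [rev_ord i] is the degree [n - (i + 1)]. *)
Lemma mev_mesym (C : idomainType) (b : 'I_m -> C) (a : 'I_n -> C) (i : 'I_n) :
  mev b a (mesym n _ i.+1) =
  (-1) ^+ i.+1 * (\prod_(j < n) ('X - (a j)%:P))`_(rev_ord i).
Proof.
have hi : (i.+1 < n.+1)%N by rewrite ltnS.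
have := mroots_coeff [tuple a j | j < n] (Ordinal hi).
rewrite big_tuple /= => h.
have -> : \prod_(j < n) ('X - (a j)%:P) =
          \prod_(j < n) ('X - (tnth [tuple a j | j < n] j)%:P).
  by apply: eq_bigr => j _; rewrite tnth_mktuple.
rewrite h mulrA -exprMn mulrNN mul1r expr1n mul1r /mesym !rmorph_sum /=.
apply: eq_bigr => S _; rewrite !rmorph_prod /=; apply: eq_bigr => j _.
by rewrite -[X in mev _ _ X]/(Xv j) mev_Xv mevalXU tnth_mktuple.
Qed.

(** The product runs over all orderings of the roots, so its coefficients are symmetric in them,
    hence polynomials in the elementary symmetric functions. The identity is established for generic
    variables and then specialized by [mev]. *)
Lemma symmetrized_coef (s : seq (pexp m n)) (k : nat) :
  exists e : pexp m n,
  forall (C : idomainType) (b : 'I_m -> C) (a : 'I_n -> C),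
    (\prod_(t : 'S_n) \prod_(x <- s) ('X - (peval b (a \o t) x)%:P))`_k =
    peval b (fun j : 'I_n => (\prod_(i < n) ('X - (a i)%:P))`_j) e.
Proof.
pose G : {poly A} :=
  \prod_(t : 'S_n) \prod_(x <- s) ('X - (peval Bv (Xv \o t) x)%:P).
have Gsym : G`_k \is symmetric.
  apply/issymP => u; rewrite -coef_map.
  suff -> : map_poly (msym u) G = G by [].
  (* Acting by [u] sends the factor of [t] to that of [t * u], so the factors are only permuted. *)
  rewrite /G rmorph_prod /= [RHS](reindex_inj (mulIg u)) /=.
  apply: eq_bigr => t _; rewrite rmorph_prod; apply: eq_bigr => x _.
  rewrite rmorphB /= map_polyX map_polyC /= msym_peval.
  by congr (_ - _%:P); apply: eq_peval => // i /=; rewrite permM.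
have [t [tG _]] := sym_fundamental Gsym.
pose y (i : 'I_n) : pexp m n := PMul (PInt ((-1) ^+ i.+1)) (PA (rev_ord i)).
have [e he] := sub_pexp_ex y t.
exists e => C b a; rewrite -he.
have -> : \prod_(t : 'S_n) \prod_(x <- s) ('X - (peval b (a \o t) x)%:P) =
          map_poly (mev b a) G.
  rewrite /G rmorph_prod; apply: eq_bigr => u _.
  rewrite rmorph_prod; apply: eq_bigr => x _.
  rewrite rmorphB /= map_polyX map_polyC /= (rmorph_peval (mev b a)).
  by congr ('X - _%:P); apply: eq_peval => i /=; rewrite ?mev_Bv ?mev_Xv.
rewrite coef_map /= -tG comp_mpolyE rmorph_sum /= {2}/mev /mmap.
apply: eq_bigr => q _; rewrite -mul_mpolyC rmorphM /= {1}/mev mmapC.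
congr (_ * _); rewrite rmorph_prod; apply: eq_bigr => i _.
rewrite rmorphXn /= tnth_mktuple mev_mesym /y /=.
by rewrite rmorphXn /= rmorphN1.
Qed.

End Symmetrization.

Require Import Defs.
From mathcomp Require Import all_classical all_reals all_analysis.
From mathcomp Require Import measurable_realfun.
From mathcomp Require Import complex.
From mathcomp Require Import ring lra.

Import numFieldNormedType.Exports.
Local Notation nrm := Normc.normc.

(** * Moduli of complex numbers *)

Section Modulus.
Variable R : rcfType.
Implicit Types z w : R[i].

Lemma nrm_ge0 z : 0 <= nrm z.
Proof. by case: z => a b; rewrite sqrtr_ge0. Qed.

Lemma nrm_eq0 z : (nrm z == 0) = (z == 0).
Proof.
by apply/eqP/eqP => [/Normc.eq0_normc //|->]; rewrite Normc.normc0.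
Qed.

Lemma nrm_gt0 z : (0 < nrm z) = (z != 0).
Proof. by rewrite lt_def nrm_ge0 andbT nrm_eq0. Qed.

Lemma nrmX z n : nrm (z ^+ n) = nrm z ^+ n.
Proof.
by elim: n => [|n IH]; rewrite ?expr0 ?Normc.normc1 // !exprS Normc.normcM IH.
Qed.

Lemma nrm_prod (I : Type) (r : seq I) (P : pred I) (F : I -> R[i]) :
  nrm (\prod_(i <- r | P i) F i) = \prod_(i <- r | P i) nrm (F i).
Proof. by apply: (big_morph _ (@Normc.normcM R) (Normc.normc1 R)). Qed.

Lemma nrm_sum (I : Type) (r : seq I) (P : pred I) (F : I -> R[i]) :
  nrm (\sum_(i <- r | P i) F i) <= \sum_(i <- r | P i) nrm (F i).
Proof.
elim/big_rec2: _ => [|i y x _ le_xy]; first by rewrite Normc.normc0.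
by apply: le_trans (le_normcD _ _) _; rewrite lerD2l.
Qed.

Lemma nrmB z w : nrm (z - w) = nrm (w - z).
Proof. by rewrite -normcN opprB. Qed.

Lemma nrm_triangle u z w : nrm (z - w) <= nrm (z - u) + nrm (u - w).
Proof. by have -> : z - w = (z - u) + (u - w); [ring | exact: le_normcD]. Qed.

Lemma nrm_nat n : nrm (n%:R : R[i]) = n%:R.
Proof. by rewrite normcMn Normc.normc1. Qed.

End Modulus.

(** * Arithmetic of integer polynomials given by lists of terms *)

Section IntegerPolynomials.
Variables (n : nat).

Definition ip_const (c : int) : intpoly n := [:: (c, [tuple 0%N | i < n])].

Definition ip_var (j : 'I_n) : intpoly n :=
  [:: (1, [tuple (i == j : nat) | i < n])].

Definition ip_mul (p q : intpoly n) : intpoly n :=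
  [seq (t.1 * u.1, [tuple (tnth t.2 i + tnth u.2 i)%N | i < n])
     | t <- p, u <- q].

Variable R : rcfType.
Implicit Type x : 'I_n -> R[i].

Lemma ipeval_const c x : ipeval (ip_const c) x = c%:~R.
Proof.
rewrite /ipeval big_seq1 /= big1 ?mulr1 // => i _.
by rewrite tnth_mktuple expr0.
Qed.

Lemma ipeval_var j x : ipeval (ip_var j) x = x j.
Proof.
rewrite /ipeval big_seq1 /= mul1r (bigD1 j) //= big1 ?mulr1.
  by rewrite tnth_mktuple eqxx expr1.
by move=> i /negPf ij; rewrite tnth_mktuple ij expr0.
Qed.

Lemma ipeval_add (p q : intpoly n) x :
  ipeval (p ++ q) x = ipeval p x + ipeval q x.
Proof. by rewrite /ipeval big_cat. Qed.

Lemma ipeval_mul (p q : intpoly n) x :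
  ipeval (ip_mul p q) x = ipeval p x * ipeval q x.
Proof.
rewrite /ipeval big_allpairs_dep mulr_suml; apply: eq_bigr => t _.
rewrite mulr_sumr; apply: eq_bigr => u _ /=.
rewrite rmorphM mulrACA -big_split /=; congr (_ * _); apply: eq_bigr => i _.
by rewrite tnth_mktuple exprD.
Qed.

(** A list may repeat an exponent vector, so the terms are grouped by vector and each group carries
    the coefficient [ipcoef]. Read contrapositively, a nonzero value certifies the nonzero
    polynomial that an [ARP] demands. *)
Lemma ipeval_zero (p : intpoly n) x : ip_is_zero p -> ipeval p x = 0.
Proof.
move=> /allP p0; pose F (e : n.-tuple nat) := \prod_(i < n) x i ^+ tnth e i.
pose U := undup [seq t.2 | t <- p].
transitivity (\sum_(t <- p) \sum_(e <- U | t.2 == e) t.1%:~R * F e).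
  rewrite /ipeval big_seq [RHS]big_seq; apply: eq_bigr => t tp.
  rewrite [RHS]big_mkcond (bigD1_seq t.2) ?undup_uniq ?mem_undup ?map_f //= eqxx.
  by rewrite [X in _ + X]big1 ?addr0 // => e; rewrite eq_sym => /negPf ->.
rewrite (exchange_big_dep xpredT) //= big_seq big1 // => e.
rewrite mem_undup => /mapP[t tp ->]; rewrite -mulr_suml -rmorph_sum /=.
by rewrite -[\sum_(_ <- _ | _) _]/(ipcoef p t.2) (eqP (p0 _ tp)) mul0r.
Qed.

End IntegerPolynomials.

Section Homogenization.
Variables (m n : nat).

(** Clears the denominators of the normalized coefficients of [Q]. For a sum, each side is
    multiplied by the power belonging to the other, so that both reach the exponent [D1 + D2]. *)
Lemma pexp_intpoly (e : pexp m n) :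
  exists (D : nat) (p : intpoly (m + n.+1)),
  forall (R : rcfType) (b1 : 'I_m -> R[i]) (b2 : 'I_n.+1 -> R[i]),
    b2 ord_max != 0 ->
    ipeval p (bcat b1 b2) =
    b2 ord_max ^+ D *
    peval b1 (fun j => b2 (widen_ord (leqnSn n) j) / b2 ord_max) e.
Proof.
pose v : 'I_(m + n.+1) := rshift m ord_max.
have hv R (b1 : 'I_m -> R[i]) (b2 : 'I_n.+1 -> R[i]) j :
    bcat b1 b2 (rshift m j) = b2 j.
  by rewrite /bcat -[rshift m j]/(unsplit (inr j)) unsplitK.
have hl R (b1 : 'I_m -> R[i]) (b2 : 'I_n.+1 -> R[i]) j :
    bcat b1 b2 (lshift n.+1 j) = b1 j.
  by rewrite /bcat -[lshift _ j]/(unsplit (inl j)) unsplitK.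
pose pw k := iter k (ip_mul (ip_var v)) (ip_const _ 1).
have hpw (R : rcfType) b1 (b2 : _ -> R[i]) k :
    ipeval (pw k) (bcat b1 b2) = b2 ord_max ^+ k.
  elim: k => [|k IH] /=; first by rewrite ipeval_const.
  by rewrite ipeval_mul IH ipeval_var hv exprS.
elim: e => [c|i|j|e1 [D1 [p1 h1]] e2 [D2 [p2 h2]]|e1 [D1 [p1 h1]] e2 [D2 [p2 h2]]].
- by exists 0%N, (ip_const _ c) => R b1 b2 _; rewrite ipeval_const mul1r.
- by exists 0%N, (ip_var (lshift _ i)) => R b1 b2 _; rewrite ipeval_var hl mul1r.
- exists 1%N, (ip_var (rshift m (widen_ord (leqnSn n) j))) => R b1 b2 b0.
  by rewrite ipeval_var hv expr1 /= mulrC divfK.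
- exists (D1 + D2)%N, (ip_mul (pw D2) p1 ++ ip_mul (pw D1) p2) => R b1 b2 b0.
  by rewrite ipeval_add !ipeval_mul !hpw h1 // h2 //= exprD; ring.
- exists (D1 + D2)%N, (ip_mul p1 p2) => R b1 b2 b0.
  by rewrite ipeval_mul h1 // h2 //= exprD; ring.
Qed.

End Homogenization.

(** * Size of the roots against size of the coefficients *)

Section RootsAndCoefficients.
Variable R : realType.
Implicit Types (s : seq R[i]) (S : R).

Lemma nrm_coef_prod_XsubC s S k : (forall w, w \in s -> nrm w <= S) ->
  (k <= size s)%N ->
  nrm (\prod_(w <- s) ('X - w%:P))`_k <= 2 ^+ size s * S ^+ (size s - k).
Proof.
elim: s k => [|w s IH] k hS.
  rewrite leqn0 => /eqP ->.
  by rewrite big_nil coefC eqxx Normc.normc1 !expr0 mulr1.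
have S0 : 0 <= S by apply: le_trans (hS w _); rewrite ?nrm_ge0 ?mem_head.
have {}IH j : (j <= size s)%N ->
    nrm (\prod_(w <- s) ('X - w%:P))`_j <= 2 ^+ size s * S ^+ (size s - j).
  by apply: IH => u us; apply: hS; rewrite inE us orbT.
move=> /= lek; rewrite big_cons mulrBl coefB coefXM coefCM exprS -mulrA.
have le1 : nrm (if k == 0%N then 0 else (\prod_(w <- s) ('X - w%:P))`_k.-1) <=
    2 ^+ size s * S ^+ ((size s).+1 - k).
  case: k lek => [|k] lek.
    by rewrite eqxx Normc.normc0 mulr_ge0 ?exprn_ge0.
  by rewrite subSS IH.
have le2 : nrm (w * (\prod_(w <- s) ('X - w%:P))`_k) <=
    2 ^+ size s * S ^+ ((size s).+1 - k).
  move: lek; rewrite leq_eqVlt => /orP[/eqP ->|].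
    rewrite nth_default ?mulr0 ?Normc.normc0 ?mulr_ge0 ?exprn_ge0 //.
    by rewrite size_prod_XsubC.
  rewrite ltnS => lek; rewrite subSn // exprS mulrCA Normc.normcM.
  by apply: ler_pM; rewrite ?nrm_ge0 ?IH ?hS ?mem_head.
apply: le_trans (le_normcD _ _) _; rewrite normcN.
by apply: le_trans (lerD le1 le2) _; rewrite -mulr2n mulr_natl.
Qed.

(** If [|w| > 2 rho], the term of degree [k] at [w] is at most [|w| ^ n / 2 ^ (n - k)]. The
    lower-order terms then add up to less than [|w| ^ n], although at a root their sum is
    [- w ^ n]. *)
Lemma cauchy_root_bound (p : {poly R[i]}) (rho : R) w :
  p \is monic -> root p w -> 0 <= rho ->
  (forall k, (k < (size p).-1)%N -> nrm p`_k <= rho ^+ ((size p).-1 - k)) ->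
  nrm w <= 2 * rho.
Proof.
move=> pm /rootP pw rho0; set n := (size p).-1 => hk.
have sp : size p = n.+1 by rewrite /n prednK // size_poly_gt0 monic_neq0.
rewrite leNgt; apply/negP => lt_w.
have w0 : 0 < nrm w by apply: le_lt_trans lt_w; rewrite mulr_ge0.
have geo : nrm (\sum_(k < n) p`_k * w ^+ k) <= nrm w ^+ n * (1 - (1 / 2) ^+ n).
  apply: le_trans (nrm_sum _ _ _) _.
  have le1 (k : 'I_n) : nrm (p`_k * w ^+ k) <= nrm w ^+ n * (1 / 2) ^+ (n - k).
    rewrite Normc.normcM nrmX.
    have -> : nrm w ^+ n * (1 / 2) ^+ (n - k) =
        (nrm w * (1 / 2)) ^+ (n - k) * nrm w ^+ k.
      by rewrite [(nrm w * _) ^+ _]exprMn mulrAC -exprD subnK // ltnW.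
    rewrite ler_wpM2r ?exprn_ge0 ?nrm_ge0 //.
    apply: le_trans (hk _ (ltn_ord k)) _.
    by rewrite lerXn2r ?nnegrE //; lra.
  apply: le_trans (ler_sum _ (fun k _ => le1 k)) _.
  rewrite -mulr_sumr ler_wpM2l ?exprn_ge0 ?nrm_ge0 //.
  clear; rewrite (reindex_inj rev_ord_inj) /=.
  elim: n => [|n IH]; first by rewrite big_ord0 expr0 subrr.
  rewrite big_ord_recr /= subKn // exprS.
  have -> : \sum_(i < n) (1 / 2 : R) ^+ (n.+1 - (n.+1 - (widen_ord (leqnSn n) i).+1)) =
            \sum_(i < n) (1 / 2) ^+ (n - (n - i.+1)).
    by apply: eq_bigr => i _; rewrite /= !subKn // ltnS ltnW.
  apply: le_trans (lerD IH (lexx _)) _.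
  by set x := (1 / 2) ^+ n; lra.
have : nrm w ^+ n <= nrm w ^+ n * (1 - (1 / 2) ^+ n).
  apply: le_trans geo; rewrite -nrmX -(normcN (w ^+ n)).
  suff -> : - w ^+ n = \sum_(k < n) p`_k * w ^+ k by [].
  move: pw; rewrite horner_coef sp big_ord_recr /=.
  have -> : p`_n = 1 by move: pm; rewrite monicE lead_coefE => /eqP.
  by rewrite mul1r => /eqP; rewrite addr_eq0 => /eqP ->.
rewrite ler_pMr ?exprn_gt0 //; have : 0 < (1 / 2 : R) ^+ n by rewrite exprn_gt0.
by lra.
Qed.

(** The coefficient of degree [k] is homogeneous of degree [n - k] in the roots; the integer
    exponent [n! / (n - k)] brings every summand to the common degree [2 n!]. *)
Lemma sum_nrm_coef_equiv n : (0 < n)%N ->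
  exists c C : R, [/\ 0 < c, 0 < C & forall s, size s = n ->
    c * (\sum_(w <- s) nrm w) ^+ (2 * n`!) <=
      \sum_(k < n) nrm ((\prod_(w <- s) ('X - w%:P))`_k ^+ (n`! %/ (n - k))) ^+ 2 /\
    \sum_(k < n) nrm ((\prod_(w <- s) ('X - w%:P))`_k ^+ (n`! %/ (n - k))) ^+ 2 <=
      C * (\sum_(w <- s) nrm w) ^+ (2 * n`!)].
Proof.
move=> n0; exists ((2 * n%:R) ^+ (2 * n`!))^-1, (n%:R * (2 ^+ n) ^+ (2 * n`!)).
have n0R : 0 < n%:R :> R by rewrite ltr0n.
split; first by rewrite invr_gt0 exprn_gt0 // mulr_gt0.
  by rewrite mulr_gt0 // !exprn_gt0.
move=> s sn; set S := \sum_(w <- s) nrm w; set p := \prod_(w <- s) _.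
have S0 : 0 <= S by apply: sumr_ge0 => w _; exact: nrm_ge0.
have hS w : w \in s -> nrm w <= S.
  move=> ws; rewrite /S (big_rem w) //= lerDl.
  by apply: sumr_ge0 => u _; exact: nrm_ge0.
have dv (k : 'I_n) : ((n - k) * (n`! %/ (n - k)) = n`!)%N.
  by rewrite mulnC divnK // dvdn_fact // subn_gt0 ltn_ord leq_subr.
have sp : size p = n.+1 by rewrite size_prod_XsubC sn.
split; last first.
  apply: le_trans (_ : \sum_(k < n) ((2 ^+ n) ^+ (2 * n`!) * S ^+ (2 * n`!)) <= _).
    apply: ler_sum => k _; rewrite nrmX -exprM.
    apply: le_trans (_ : (2 ^+ n * S ^+ (n - k)) ^+ (n`! %/ (n - k) * 2) <= _).
      rewrite lerXn2r ?nnegrE ?nrm_ge0 ?mulr_ge0 ?exprn_ge0 //.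
      by have := @nrm_coef_prod_XsubC s S k hS; rewrite sn; apply; exact: ltnW.
    rewrite exprMn -[X in _ * X]exprM mulnA dv [(n`! * 2)%N]mulnC.
    rewrite ler_wpM2r ?exprn_ge0 // ler_weXn2l ?exprn_ege1 ?ler1n //.
    by rewrite mulnC leq_mul2l leq_div.
  by rewrite sumr_const card_ord -mulrA [leRHS]mulr_natl.
set E := \sum_(k < n) _.
have E0 : 0 <= E by apply: sumr_ge0 => k _; rewrite exprn_ge0 ?nrm_ge0.
have f0 : (0 < 2 * n`!)%N by rewrite muln_gt0 fact_gt0.
(* Each summand is at most [E], which becomes Cauchy's hypothesis [|p_k| <= rho ^ (n - k)]. *)
pose rho := E `^ ((2 * n`!)%:R^-1).
have rhoE : rho ^+ (2 * n`!) = E.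
  rewrite -powR_mulrn ?powR_ge0 // -powRrM mulVf ?powRr1 //.
have rho0 : 0 <= rho by rewrite powR_ge0.
have hw w : w \in s -> nrm w <= 2 * rho.
  move=> ws; apply: (@cauchy_root_bound p).
  - exact: monic_prod_XsubC.
  - by rewrite root_prod_XsubC.
  - exact: rho0.
  rewrite sp /= => k kn.
  have := dv (Ordinal kn); set d := (_ %/ _)%N => /= dvk.
  have d0 : (0 < d)%N.
    rewrite lt0n; apply/eqP => d0; move: dvk (fact_gt0 n).
    by rewrite d0 muln0 => <-.
  rewrite -(@ler_pXn2r _ (d * 2)%N) ?muln_gt0 ?d0 ?nnegrE ?nrm_ge0 ?exprn_ge0 //.
  rewrite -exprM mulnA dvk [(n`! * 2)%N]mulnC rhoE /E.
  rewrite (bigD1 (Ordinal kn)) //= -/d nrmX -exprM lerDl.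
  by apply: sumr_ge0 => j _; rewrite exprn_ge0 ?nrm_ge0.
rewrite ler_pdivrMl ?exprn_gt0 ?mulr_gt0 // -rhoE -exprMn.
rewrite lerXn2r ?nnegrE ?mulr_ge0 //.
rewrite /S big_seq; apply: le_trans (ler_sum _ hw) _.
by rewrite -big_seq big_const_seq count_predT sn iter_addr_0 [leRHS]mulrAC mulr_natr.
Qed.

End RootsAndCoefficients.

Section SymmetrizedFamilies.
Variables (R : realType) (m n : nat).

Definition abs_sum (s : seq (pexp m n)) (b : 'I_m -> R[i]) (a : 'I_n -> R[i]) : R :=
  \sum_(e <- s) nrm (peval b a e).

Lemma abs_sum_ge0 s b a : 0 <= abs_sum s b a.
Proof. by apply: sumr_ge0 => e _; exact: nrm_ge0. Qed.

Definition sym_abs_sum s b (a : 'I_n -> R[i]) : R :=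
  \sum_(t : 'S_n) abs_sum s b (a \o t).

Fixpoint pexp_pow (e : pexp m n) k : pexp m n :=
  if k is k'.+1 then PMul e (pexp_pow e k') else PInt 1.

Lemma peval_pow (C : comNzRingType) (b : 'I_m -> C) (a : 'I_n -> C) e k :
  peval b a (pexp_pow e k) = peval b a e ^+ k.
Proof. by elim: k => [|k IH] //=; rewrite exprS IH. Qed.

(** The values of all members of [s] at all orderings of the roots form one family of [K] numbers.
    The coefficients of the monic polynomial with these roots are integer polynomials in [b1] and
    the normalized [b2], and their weighted square sum measures the family. *)
Lemma sym_abs_sum_equiv (s : seq (pexp m n)) : (0 < size s)%N ->
  exists (ps : seq (intpoly (m + n.+1))) (h : nat) (c C : R),
  [/\ (0 < h)%N, 0 < c, 0 < C &
   forall (b1 : 'I_m -> R[i]) (b2 : 'I_n.+1 -> R[i]) (a : 'I_n -> R[i]),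
    1 / 2 <= nrm (b2 ord_max) <= 2 ->
    (forall j : 'I_n, b2 (widen_ord (leqnSn n) j) / b2 ord_max =
                      (\prod_(i < n) ('X - (a i)%:P))`_j) ->
    c * sym_abs_sum s b1 a ^+ (2 * h) <=
      \sum_(p <- ps) nrm (ipeval p (bcat b1 b2)) ^+ 2 /\
    \sum_(p <- ps) nrm (ipeval p (bcat b1 b2)) ^+ 2 <=
      C * sym_abs_sum s b1 a ^+ (2 * h)].
Proof.
move=> s0; pose K := (#|{: 'S_n}| * size s)%N.
have K0 : (0 < K)%N by rewrite muln_gt0 s0 andbT; apply/card_gt0P; exists 1%g.
have [c [C [c0 C0 hcC]]] := sum_nrm_coef_equiv R K0.
have ex (k : 'I_K) : exists Dp : nat * intpoly (m + n.+1),
  forall (b1 : 'I_m -> R[i]) (b2 : 'I_n.+1 -> R[i]) (a : 'I_n -> R[i]),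
    b2 ord_max != 0 ->
    (forall j : 'I_n, b2 (widen_ord (leqnSn n) j) / b2 ord_max =
                      (\prod_(i < n) ('X - (a i)%:P))`_j) ->
    ipeval Dp.2 (bcat b1 b2) = b2 ord_max ^+ Dp.1 *
    (\prod_(t : 'S_n) \prod_(x <- s) ('X - (peval b1 (a \o t) x)%:P))`_k
       ^+ (K`! %/ (K - k)).
  have [e he] := symmetrized_coef s k.
  have [D [p hp]] := pexp_intpoly (pexp_pow e (K`! %/ (K - k))).
  exists (D, p) => b1 b2 a b0 ha; rewrite hp //= peval_pow he.
  by congr (_ * _ ^+ _); apply: eq_peval => // j; rewrite ha.
have [Dp hDp] := choice ex.
(* [Dm] dominates all homogenizing exponents; with the leading coefficient between [1 / 2] and 2,
   they cost at most a factor [2 ^ (2 Dm)] either way. *)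
pose Dm := (\sum_(k < K) (Dp k).1)%N.
have leD k : ((Dp k).1 <= Dm)%N by rewrite /Dm (bigD1 k) //= leq_addr.
exists [seq (Dp k).2 | k <- enum 'I_K], K`!.
exists (c * (1 / 2) ^+ (Dm * 2)), (C * 2 ^+ (Dm * 2)).
split; rewrite ?fact_gt0 ?mulr_gt0 ?exprn_gt0 //.
move=> b1 b2 a /andP[b2l b2u] ha.
have half0 : 0 <= 1 / 2 :> R by lra.
have half1 : 1 / 2 <= 1 :> R by lra.
have one2 : 1 <= 2 :> R by lra.
have b20 : b2 ord_max != 0 by rewrite -nrm_gt0; lra.
pose W := [seq peval b1 (a \o (t : 'S_n)) x
             | t : 'S_n <- index_enum {: 'S_n}, x : pexp m n <- s].
have W1 : \sum_(w <- W) nrm w = sym_abs_sum s b1 a.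
  by rewrite /W big_allpairs_dep.
have sW : size W = K.
  by rewrite /W size_allpairs -[index_enum _]enumT -cardE.
have [] := hcC W sW; rewrite W1.
have -> : \prod_(w <- W) ('X - w%:P) =
    \prod_(t : 'S_n) \prod_(x <- s) ('X - (peval b1 (a \o t) x)%:P).
  by rewrite /W big_allpairs_dep.
set f := \prod_(t : 'S_n) _; set E := \sum_(k < K) _; move=> lo up.
rewrite big_map big_enum /=.
have eqE : \sum_(k < K) nrm (ipeval (Dp k).2 (bcat b1 b2)) ^+ 2 =
   \sum_(k < K) (nrm (b2 ord_max) ^+ ((Dp k).1 * 2) *
                 nrm (f`_k ^+ (K`! %/ (K - k))) ^+ 2).
  apply: eq_bigr => k _.
  by rewrite (hDp k _ _ _ b20 ha) Normc.normcM exprMn nrmX -exprM.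
have b0 := nrm_ge0 (b2 ord_max).
rewrite eqE; split.
  rewrite -mulrA [_ * sym_abs_sum _ _ _ ^+ _]mulrC mulrA.
  have h0 : 0 <= (1 / 2) ^+ (Dm * 2) :> R by rewrite exprn_ge0.
  apply: le_trans (ler_wpM2r h0 lo) _.
  rewrite /E mulr_suml; apply: ler_sum => k _; rewrite mulrC.
  rewrite ler_wpM2r ?exprn_ge0 ?nrm_ge0 //.
  apply: le_trans (_ : (1 / 2) ^+ ((Dp k).1 * 2) <= _).
    by apply: ler_wiXn2l; rewrite ?leq_mul2r ?leD.
  by rewrite lerXn2r ?nnegrE.
rewrite -mulrA [2 ^+ _ * _]mulrC mulrA.
have h0 : 0 <= 2 ^+ (Dm * 2) :> R by rewrite exprn_ge0.
apply: le_trans (ler_wpM2r h0 up).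
rewrite /E mulr_suml; apply: ler_sum => k _; rewrite [leRHS]mulrC.
rewrite ler_wpM2r ?exprn_ge0 ?nrm_ge0 //.
apply: le_trans (_ : 2 ^+ ((Dp k).1 * 2) <= _); last first.
  by apply: ler_weXn2l; rewrite ?leq_mul2r ?leD.
by rewrite lerXn2r ?nnegrE.
Qed.

End SymmetrizedFamilies.

(** * Functions that are sums of moduli of integer polynomials *)

Section Representable.
Variables (R : realType) (m n : nat).
Implicit Types f g : ('I_m -> R[i]) -> ('I_n -> R[i]) -> R.

Definition int_poly_fun (f : ('I_m -> R[i]) -> ('I_n -> R[i]) -> R[i]) :=
  exists e : pexp m n, forall b a, peval b a e = f b a.

(** Exact equality is affordable because the modulus is multiplicative: such sums are closed under
    addition and multiplication. *)
Definition abs_summable f :=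
  exists s : seq (pexp m n), forall b a, abs_sum s b a = f b a.

Lemma ipf_int c : int_poly_fun (fun _ _ => c%:~R).
Proof. by exists (PInt c). Qed.

Lemma ipf_b i : int_poly_fun (fun b _ => b i).
Proof. by exists (PB i). Qed.

Lemma ipf_a j : int_poly_fun (fun _ a => a j).
Proof. by exists (PA j). Qed.

Lemma ipf_mul u v : int_poly_fun u -> int_poly_fun v ->
  int_poly_fun (fun b a => u b a * v b a).
Proof. by move=> [e1 h1] [e2 h2]; exists (PMul e1 e2) => b a /=; rewrite h1 h2. Qed.

Lemma ipf_sub u v : int_poly_fun u -> int_poly_fun v ->
  int_poly_fun (fun b a => u b a - v b a).
Proof.
move=> [e1 h1] [e2 h2]; exists (PAdd e1 (PMul (PInt (-1)) e2)) => b a /=.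
by rewrite h1 h2 mulN1r.
Qed.

Lemma ipf_exp u k : int_poly_fun u -> int_poly_fun (fun b a => u b a ^+ k).
Proof.
by move=> [e he]; exists (pexp_pow e k) => b a; rewrite peval_pow he.
Qed.

Lemma ipf_sum (I : Type) (r : seq I) F : (forall i, int_poly_fun (F i)) ->
  int_poly_fun (fun b a => \sum_(i <- r) F i b a).
Proof.
move=> h; elim: r => [|i r [e2 h2]].
  by exists (PInt 0) => b a; rewrite big_nil.
by have [e1 h1] := h i; exists (PAdd e1 e2) => b a; rewrite big_cons /= h1 h2.
Qed.

Lemma abss_nrm u : int_poly_fun u -> abs_summable (fun b a => nrm (u b a)).
Proof. by move=> [e he]; exists [:: e] => b a; rewrite /abs_sum big_seq1 he. Qed.

Lemma abss_add f g : abs_summable f -> abs_summable g ->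
  abs_summable (fun b a => f b a + g b a).
Proof.
move=> [s1 h1] [s2 h2]; exists (s1 ++ s2) => b a.
by rewrite /abs_sum big_cat /= -h1 -h2.
Qed.

Lemma abss_mul f g : abs_summable f -> abs_summable g ->
  abs_summable (fun b a => f b a * g b a).
Proof.
move=> [s1 h1] [s2 h2]; exists [seq PMul e1 e2 | e1 <- s1, e2 <- s2] => b a.
rewrite /abs_sum big_allpairs_dep -h1 -h2 mulr_suml; apply: eq_bigr => e1 _.
by rewrite mulr_sumr; apply: eq_bigr => e2 _; rewrite /= Normc.normcM.
Qed.

Lemma abss1 : abs_summable (fun _ _ => 1).
Proof.
by exists [:: PInt 1] => b a; rewrite /abs_sum big_seq1 Normc.normc1.
Qed.

Lemma abss_exp f k : abs_summable f -> abs_summable (fun b a => f b a ^+ k).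
Proof.
move=> hf; elim: k => [|k IH]; first exact: abss1.
have [s hs] := abss_mul hf IH.
by exists s => b a; rewrite hs exprS.
Qed.

Lemma abss_sum (I : Type) (r : seq I) (P : pred I) F :
  (forall i, abs_summable (F i)) ->
  abs_summable (fun b a => \sum_(i <- r | P i) F i b a).
Proof.
move=> h; elim: r => [|i r hr].
  by exists [::] => b a; rewrite big_nil /abs_sum big_nil.
have [s hs] : abs_summable (fun b a =>
    if P i then F i b a + \sum_(i <- r | P i) F i b a
    else \sum_(i <- r | P i) F i b a).
  by case: (P i) => //; exact: abss_add.
by exists s => b a; rewrite big_cons hs.
Qed.

Lemma abss_prod (I : Type) (r : seq I) (P : pred I) F :
  (forall i, abs_summable (F i)) ->
  abs_summable (fun b a => \prod_(i <- r | P i) F i b a).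
Proof.
move=> h; elim: r => [|i r hr].
  by have [s hs] := abss1; exists s => b a; rewrite big_nil hs.
have [s hs] : abs_summable (fun b a =>
    if P i then F i b a * \prod_(i <- r | P i) F i b a
    else \prod_(i <- r | P i) F i b a).
  by case: (P i) => //; exact: abss_mul.
by exists s => b a; rewrite big_cons hs.
Qed.

End Representable.

(** * Majorants by dyadic squares *)

Section Squares.
Local Open Scope classical_set_scope.
Variable R : realType.
Notation mu := (@lebC R).

Definition box (x y : R) (u v : R) : set (R * R) := `[x, x + u] `*` `[y, y + v].

Lemma measurable_box (x y u v : R) : measurable (box x y u v).
Proof. by apply: measurableX; exact: measurable_itv. Qed.

Lemma lebC_box (x y u v : R) : 0 <= u -> 0 <= v -> mu (box x y u v) = (u * v)%:E.
Proof.
move=> u0 v0; rewrite /lebC /box product_measure1E; try exact: measurable_itv.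
rewrite /= !lebesgue_measure_itv /= !lte_fin.
have E (a c : R) : 0 <= c -> (if a < a + c then ((a + c)%:E - a%:E)%E else 0%E) = c%:E.
  move=> c0; case: ltP => h; first by rewrite -EFinB addrC addKr.
  by congr EFin; apply/eqP; rewrite eq_le c0 /=; lra.
by rewrite !E.
Qed.

Lemma measurable_unit_disk : measurable (@unit_disk R).
Proof.
have m1 : measurable_fun setT (fun p : R * R => p.1 ^+ 2 + p.2 ^+ 2).
  apply: measurable_funD; apply: measurable_funX.
    exact: measurable_fst.
  exact: measurable_snd.
have -> : @unit_disk R = setT `&` (fun p : R * R => p.1 ^+ 2 + p.2 ^+ 2) @^-1` `]-oo, 1[.
  by rewrite setTI; apply/seteqP; split => p; rewrite /unit_disk /= in_itv.
exact: m1.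
Qed.

(** Induction along Horner's scheme, with both parts together because multiplication by [z] mixes
    them. *)
Lemma measurable_Re_Im_horner (p : {poly R[i]}) :
  measurable_fun setT (fun z : R * R => complex.Re p.[cplx z]) /\
  measurable_fun setT (fun z : R * R => complex.Im p.[cplx z]).
Proof.
elim/poly_ind: p => [|p c [hR hI]].
  by split; under eq_fun do rewrite horner0; exact: measurable_cst.
have E (z : R * R) : (p * 'X + c%:P).[cplx z] =
   Complex (complex.Re p.[cplx z] * z.1 - complex.Im p.[cplx z] * z.2 + complex.Re c)
     (complex.Re p.[cplx z] * z.2 + complex.Im p.[cplx z] * z.1 + complex.Im c).
  by rewrite hornerMXaddC; case: (p.[_]) => a b; case: c => x y; rewrite /cplx.
split; under eq_fun do rewrite E /=.
  apply: measurable_funD; last exact: measurable_cst.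
  by apply: measurable_funB; apply: measurable_funM.
apply: measurable_funD; last exact: measurable_cst.
by apply: measurable_funD; apply: measurable_funM.
Qed.

Lemma measurable_nrm_horner (p : {poly R[i]}) :
  measurable_fun setT (fun z : R * R => nrm p.[cplx z]).
Proof.
have [hR hI] := measurable_Re_Im_horner p.
have -> : (fun z : R * R => nrm p.[cplx z]) =
   (fun x : R => x `^ 2^-1) \o
   (fun z => complex.Re p.[cplx z] ^+ 2 + complex.Im p.[cplx z] ^+ 2).
  apply/funext => z /=; rewrite powR12_sqrt ?addr_ge0 ?sqr_ge0 //.
  by case: (p.[_]).
apply: measurableT_comp; first exact: measurable_powR.
by apply: measurable_funD; apply: measurable_funX.
Qed.

Lemma measurable_integrand (p q : {poly R[i]}) (e d : R) :
  measurable_fun setT (fun z : R * R =>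
    (nrm p.[cplx z] `^ e / nrm q.[cplx z] `^ d)%:E).
Proof.
apply/measurable_EFinP.
under eq_fun do rewrite -powRN.
apply: measurable_funM.
  by apply: (measurableT_comp (measurable_powR e)); exact: measurable_nrm_horner.
by apply: (measurableT_comp (measurable_powR (- d))); exact: measurable_nrm_horner.
Qed.

End Squares.

(** * Radial powers dominated by series of squares *)

Section DyadicMajorant.
Local Open Scope classical_set_scope.
Variable R : realType.
Notation mu := (@lebC R).
Implicit Types (x t s sg : R) (al : R[i]).

(** It contains the disk of radius [r] about [al], and its measure is a mere product of lengths. *)
Definition csquare al r : set (R * R) :=
  box (complex.Re al - r) (complex.Im al - r) (2 * r) (2 * r).

Lemma norm_Re_le (z : R[i]) : `|complex.Re z| <= nrm z.
Proof.
case: z => a b /=; rewrite -sqrtr_sqr ler_wsqrtr // lerDl; exact: sqr_ge0.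
Qed.

Lemma norm_Im_le (z : R[i]) : `|complex.Im z| <= nrm z.
Proof.
case: z => a b /=; rewrite -sqrtr_sqr ler_wsqrtr // lerDr; exact: sqr_ge0.
Qed.

Lemma csquare_mem al r (p : R * R) : nrm (cplx p - al) <= r -> csquare al r p.
Proof.
have := norm_Re_le (cplx p - al); have := norm_Im_le (cplx p - al).
case: p => u v; case: al => a b /= /ler_normlP[h1 h2] /ler_normlP[h3 h4] h.
by rewrite /csquare /box /= !in_itv /=; split; apply/andP; split; lra.
Qed.

Lemma dyadic_floor x : 1 <= x -> exists n, 2 ^+ n <= x < 2 ^+ n.+1.
Proof.
move=> x1; have ex : exists n, x < 2 ^+ n.
  by exists (Num.bound x); exact: upper_nthrootP.
case: (ex_minnP ex) => n hn hmin; case: n hn hmin => [|n] hn hmin.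
  by move: hn; rewrite expr0 ltNge x1.
by exists n; rewrite hn andbT leNgt; apply/negP => /hmin; rewrite ltnn.
Qed.

(** Whatever the sign of [sg], [t ^ sg >= 2 ^ (- |sg|)] for [t] between 1 and 2: rounding [x] up to
    a dyadic value changes its power by a bounded factor. *)
Lemma powR_dyadic_le x t sg : 0 < x -> 1 <= t <= 2 ->
  x `^ sg <= 2 `^ `|sg| * (t * x) `^ sg.
Proof.
move=> x0 /andP[t1 t2]; rewrite powRM; [|lra|exact: ltW].
rewrite mulrA ler_peMl ?powR_ge0 //.
apply: le_trans (_ : t `^ `|sg| * t `^ (- `|sg|) <= _).
  by rewrite -powRD ?subrr ?powRr0 // implybE; apply/orP; right; apply/eqP; lra.
apply: ler_pM; rewrite ?powR_ge0 //.
  by apply: ge0_ler_powR; rewrite ?nnegrE //; lra.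
by apply: ler_powR => //; rewrite lerNl -normrN; exact: ler_norm.
Qed.

(** Ratio of successive radii: they shrink when [r ^ sg] is integrable near 0 in the plane, and grow
    when it is to be integrated towards infinity. *)
Definition dyad sg : R := if -2 < sg then 1 / 2 else 2.

Lemma dyad_gt0 sg : 0 < dyad sg.
Proof. by rewrite /dyad; case: ifP => _; lra. Qed.

(** This power is the ratio of successive terms of the integrated series: [dyad sg ^ sg] for the
    weight and [dyad sg ^ 2] for the area. Nonresonance is what keeps it below 1. *)
Lemma dyad_lt1 sg : sg + 2 != 0 -> dyad sg `^ (sg + 2) < 1.
Proof.
have e1 (x : R) : 1 `^ x = 1 by rewrite powR1.
move=> sg2; rewrite /dyad; case: (ltP (-2) sg) => h.
  rewrite -[ltRHS](e1 (sg + 2)) gt0_ltr_powR ?nnegrE //; lra.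
have lt0 : sg + 2 < 0 by rewrite lt_neqAle sg2 /=; lra.
rewrite -[sg + 2]opprK powRN invf_lt1 ?powR_gt0 //.
rewrite -[ltLHS](e1 (- (sg + 2))) gt0_ltr_powR ?nnegrE //; lra.
Qed.

(** With [x = r / s], the radius lies on the side of [s] on which the integral of [r ^ sg] is
    governed by its value at [s]. *)
Definition reaches sg x := if -2 < sg then x <= 1 else 1 <= x.

Lemma powR_dyad_le sg x : 0 < x -> reaches sg x ->
  exists n, x <= dyad sg ^+ n /\
    x `^ sg <= 2 `^ `|sg| * (dyad sg `^ sg) ^+ n.
Proof.
move=> x0; rewrite /reaches /dyad.
have sw (th : R) n : 0 <= th -> (th `^ sg) ^+ n = (th ^+ n) `^ sg.
  move=> th0; elim: n => [|n IH]; first by rewrite !expr0 powR1.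
  by rewrite !exprS IH powRM // exprn_ge0.
case: ifP => _ hx.
  have [n /andP[n1 n2]] : exists n, 2 ^+ n <= x^-1 < 2 ^+ n.+1.
    by apply: dyadic_floor; rewrite invf_ge1.
  have p0 : 0 < 2 ^+ n :> R by rewrite exprn_gt0.
  have e : (1 / 2) ^+ n = (2 ^+ n)^-1 :> R by rewrite div1r exprVn.
  have le1 : x <= (1 / 2) ^+ n by rewrite e -[x]invrK lef_pV2 ?posrE ?invr_gt0.
  exists n; split => //; rewrite sw; last lra.
  have -> : (1 / 2) ^+ n = (1 / 2) ^+ n / x * x by rewrite divfK // gt_eqF.
  apply: powR_dyadic_le => //; apply/andP; split.
    by rewrite ler_pdivlMr // [leLHS]mul1r.
  rewrite ler_pdivrMr // e -[leLHS]mul1r ler_pdivrMr //.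
  move: n2; rewrite exprS -(ltr_pM2r x0) mulVf ?gt_eqF // => n2.
  by rewrite -mulrA [x * _]mulrC mulrA ltW.
have [n /andP[n1 n2]] := dyadic_floor hx.
exists n.+1; split; first exact: ltW.
rewrite sw //; have -> : 2 ^+ n.+1 = 2 ^+ n.+1 / x * x by rewrite divfK // gt_eqF.
apply: powR_dyadic_le => //; apply/andP; split.
  by rewrite ler_pdivlMr // [leLHS]mul1r ltW.
by rewrite ler_pdivrMr // exprS ler_pM2l.
Qed.

Local Open Scope ereal_scope.

Definition majorant sg al s (p : R * R) : \bar R :=
  \sum_(n <oo) ((((dyad sg `^ sg) ^+ n)%R)%:E *
                (\1_(csquare al (dyad sg ^+ n * s)%R) p)%:E).

Lemma majorant_term_ge0 sg al s n p :
  0 <= (((dyad sg `^ sg) ^+ n)%R)%:E * (\1_(csquare al (dyad sg ^+ n * s)%R) p)%:E.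
Proof. by rewrite -EFinM lee_fin mulr_ge0 ?exprn_ge0 ?powR_ge0. Qed.

Lemma majorant_ge0 sg al s p : 0 <= majorant sg al s p.
Proof. by apply: nneseries_ge0 => n _ _; exact: majorant_term_ge0. Qed.

Lemma measurable_majorant_term sg al s n D : measurable_fun D (fun p =>
  (((dyad sg `^ sg) ^+ n)%R)%:E * (\1_(csquare al (dyad sg ^+ n * s)%R) p)%:E).
Proof.
apply: measurable_funeM; apply/measurable_EFinP; apply: measurable_indic.
exact: measurable_box.
Qed.

Lemma measurable_majorant sg al s D :
  measurable D -> measurable_fun D (majorant sg al s).
Proof.
move=> mD; apply: ge0_emeasurable_sum.
  by move=> n p _ _; exact: majorant_term_ge0.
by move=> n _; exact: measurable_majorant_term.
Qed.

(** One term suffices: the one whose square has half-side [s] times the dyadic value just above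
    [r / s]. *)
Lemma powR_le_majorant sg al s (p : R * R) :
  (0 < s)%R -> (0 < nrm (cplx p - al))%R -> reaches sg (nrm (cplx p - al) / s)%R ->
  (((nrm (cplx p - al) / s) `^ sg)%R)%:E <= ((2 `^ `|sg|)%R)%:E * majorant sg al s p.
Proof.
move=> s0 r0 hr; have [|n [n1 n2]] := powR_dyad_le _ hr; first by rewrite divr_gt0.
have mem : csquare al (dyad sg ^+ n * s)%R p.
  by apply: csquare_mem; rewrite -ler_pdivrMr.
apply: le_trans (_ : ((2 `^ `|sg|)%R)%:E * (((dyad sg `^ sg) ^+ n)%R)%:E <= _).
  by rewrite -EFinM lee_fin.
rewrite lee_wpmul2l ?lee_fin ?powR_ge0 //.
pose u k := (((dyad sg `^ sg) ^+ k)%R)%:E * (\1_(csquare al (dyad sg ^+ k * s)%R) p)%:E.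
apply: le_trans (nneseries_lim_ge n.+1 (u_ := u) (P := xpredT) (m := 0%N) _); last first.
  by move=> k _ _; exact: majorant_term_ge0.
rewrite big_nat_recr //= /u [X in _ <= _ + X](_ : _ = (((dyad sg `^ sg) ^+ n)%R)%:E).
  by rewrite leeDr //; apply: sume_ge0 => k _; exact: majorant_term_ge0.
by rewrite indicE mem_set // mule1.
Qed.

Lemma nneseries_geometric_le (a q : R) : (0 <= a)%R -> (0 < q < 1)%R ->
  \sum_(n <oo) (a * q ^+ n)%:E <= (a / (1 - q))%:E.
Proof.
move=> a0 /andP[q0 q1]; apply: lime_le.
  by apply: is_cvg_nneseries => n _ _; rewrite lee_fin mulr_ge0 // exprn_ge0 // ltW.
apply: nearW => n; rewrite sumEFin lee_fin.
by have := @geometric_le_lim R n a q a0 q0; rewrite gtr0_norm //; apply.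
Qed.

Lemma integral_majorant_le sg al s D : measurable D -> (0 < s)%R ->
  (sg + 2 != 0)%R ->
  \int[mu]_(p in D) majorant sg al s p <=
    (4 * s ^+ 2 / (1 - dyad sg `^ (sg + 2)))%R%:E.
Proof.
move=> mD s0 sg2; have r0 := dyad_gt0 sg.
rewrite /majorant integral_nneseries //; last 2 first.
- by move=> n; exact: measurable_majorant_term.
- by move=> n p _; exact: majorant_term_ge0.
apply: le_trans (nneseries_geometric_le _ _); last 2 first.
- by rewrite mulr_ge0 // sqr_ge0.
- by rewrite powR_gt0 // dyad_lt1.
apply: lee_nneseries => [n _ _|n _].
  by apply: integral_ge0 => p _; exact: majorant_term_ge0.
have mB : measurable (csquare al (dyad sg ^+ n * s)%R) by exact: measurable_box.
rewrite ge0_integralZl_EFin ?exprn_ge0 ?powR_ge0 //; last first.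
  by apply/measurable_EFinP; exact: measurable_indic.
rewrite integral_indic //.
apply: le_trans (_ : (((dyad sg `^ sg) ^+ n)%R)%:E *
                     mu (csquare al (dyad sg ^+ n * s)%R) <= _).
  rewrite lee_wpmul2l ?lee_fin ?exprn_ge0 ?powR_ge0 //.
  by apply: le_measure; rewrite ?inE //; exact: measurableI.
have q0 : (0 <= 2 * (dyad sg ^+ n * s))%R.
  by rewrite !mulr_ge0 ?exprn_ge0 // ltW.
rewrite lebC_box // -EFinM lee_fin.
rewrite powRD; last by rewrite implybE; apply/orP; right; rewrite gt_eqF.
have -> : (dyad sg `^ 2 = dyad sg ^+ 2)%R by rewrite -powR_mulrn // ltW.
rewrite [((_ * _) ^+ n)%R]exprMn -[(dyad sg ^+ 2 ^+ n)%R]exprM mulnC exprM.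
set x := ((dyad sg `^ sg) ^+ n)%R; set y := (dyad sg ^+ n)%R.
by rewrite le_eqVlt; apply/orP; left; apply/eqP; ring.
Qed.

End DyadicMajorant.

(** * The lower bound *)

Section Interpolation.
Variable R : realType.
Implicit Types (f : {poly R[i]}) (m g : R).

(** Induction on the number of nodes. Dividing [f - f(w)] by [X - w] at one node [w] leaves a
    quotient of lower degree, bounded by [2 m / g] at the other nodes because these are [g] away
    from [w]. *)
Lemma interpolation_bound g n : 0 < g -> exists c : R, 0 < c /\
  forall f (z : 'I_n -> R[i]) m, 0 <= m -> (size f <= n)%N ->
    (forall i, nrm (z i) <= 1) ->
    (forall i j, i != j -> g <= nrm (z i - z j)) ->
    (forall i, nrm f.[z i] <= m) ->
    \sum_(k < n) nrm f`_k <= c * m.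
Proof.
move=> g0; elim: n => [|n [c [c0 IH]]].
  by exists 1; split => // f z m m0 _ _ _ _; rewrite big_ord0 mul1r.
(* From [f = f(w) + q (X - w)] with [|w| <= 1]: [m] for the constant, and twice the coefficient sum
   of [q]. *)
exists (1 + 2 * (c * (2 / g))); split.
  by rewrite addr_gt0 // !mulr_gt0 // invr_gt0.
move=> f z m m0 sf z1 zg fm; set w := z ord0.
have [q fq] : exists q : {poly R[i]}, f - f.[w]%:P = q * ('X - w%:P).
  by apply/factor_theorem/rootP; rewrite !hornerE subrr.
have sq : (size q <= n)%N.
  have [->|q0] := eqVneq q 0; first by rewrite size_poly0.
  rewrite -ltnS; apply: leq_trans sf.
  have : size (q * ('X - w%:P)) = (size q).+1.
    by rewrite size_Mmonic ?monicXsubC // size_XsubC addn2.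
  rewrite -fq => <-; apply: leq_trans (size_polyD _ _) _.
  rewrite size_polyN geq_max leqnn /=; apply: leq_trans (size_polyC_leq1 _) _.
  rewrite lt0n size_poly_eq0; apply/eqP => f0; move: fq q0.
  rewrite f0 horner0 subr0 => /esym/eqP.
  by rewrite mulf_eq0 polyXsubC_eq0 orbF => /eqP ->; rewrite eqxx.
have fE : f = f.[w]%:P + q * ('X - w%:P) by rewrite -fq addrC subrK.
have qm (i : 'I_n) : nrm q.[z (lift ord0 i)] <= 2 / g * m.
  have ne : lift ord0 i != ord0 by rewrite eq_sym neq_lift.
  have := zg _ _ ne; set u := z _ => gu.
  have u0 : 0 < nrm (u - w) by apply: lt_le_trans gu.
  have e : q.[u] * (u - w) = f.[u] - f.[w].
    by have := congr1 (fun h : {poly R[i]} => h.[u]) fq; rewrite !hornerE => ->.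
  have le1 : nrm q.[u] * nrm (u - w) <= 2 * m.
    rewrite -Normc.normcM e; apply: le_trans (le_normcD _ _) _.
    by rewrite normcN mulr_natl mulr2n; apply: lerD; exact: fm.
  rewrite mulrAC ler_pdivlMr //; apply: le_trans le1.
  by rewrite ler_wpM2l ?nrm_ge0.
have m0' : 0 <= 2 / g * m by rewrite !mulr_ge0 // invr_ge0 ltW.
have zg' i j : i != j -> g <= nrm (z (lift ord0 i) - z (lift ord0 j)).
  by move=> ij; apply: zg; rewrite (inj_eq lift_inj).
have := IH q (fun i => z (lift ord0 i)) _ m0' sq (fun i => z1 _) zg' qm.
set S := \sum_(k < n) nrm q`_k; move=> leS.
have S0 : 0 <= S by apply: sumr_ge0 => k _; exact: nrm_ge0.
have coefE k : f`_k = (if k == 0%N then f.[w] else 0) +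
    ((if k == 0%N then 0 else q`_k.-1) - q`_k * w).
  by rewrite {1}fE coefD coefC mulrBr coefB coefMX coefMC.
have -> : (1 + 2 * (c * (2 / g))) * m = m + (c * (2 / g * m) + c * (2 / g * m)).
  by ring.
apply: le_trans (_ : m + (S + S) <= _); last by rewrite lerD2l lerD.
apply: le_trans (_ : \sum_(k < n.+1) (nrm (if (k : nat) == 0%N then f.[w] else 0) +
   (nrm (if (k : nat) == 0%N then 0 else q`_k.-1) + nrm q`_k)) <= _).
  apply: ler_sum => k _; rewrite coefE.
  apply: le_trans (le_normcD _ _) _; rewrite lerD2l.
  apply: le_trans (le_normcD _ _) _; rewrite lerD2l normcN Normc.normcM.
  by rewrite ler_piMr ?nrm_ge0 ?z1.
rewrite !big_split /= big_ord_recl big1 => [|k _]; last exact: Normc.normc0.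
rewrite addr0; apply: lerD; first exact: fm.
apply: lerD.
  by rewrite big_ord_recl Normc.normc0 add0r.
by rewrite big_ord_recr /= nth_default // Normc.normc0 addr0.
Qed.

(** Boxes of width [h] separated by gaps [h], all inside [[0, 1/4] x [0, 1/16]]. There are as many
    as a polynomial of degree at most [M] needs interpolation nodes. *)
Definition patch_cell (M : nat) (l : 'I_M.+1) (w : R[i]) :=
  let h := (8 * M.+1%:R)^-1 in
  2 * l%:R * h <= complex.Re w <= 2 * l%:R * h + h /\
  0 <= complex.Im w <= 1 / 16.

Lemma patch_nrm M (l : 'I_M.+1) w : patch_cell l w -> nrm w <= 5 / 16.
Proof.
set h := (8 * M.+1%:R)^-1 : R; move=> [/andP[h1 h2] /andP[h3 h4]].
have h0 : 0 < h by rewrite invr_gt0 mulr_gt0 // ltr0n.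
have lM : l%:R <= M%:R :> R by rewrite ler_nat -ltnS.
have l0 : 0 <= l%:R :> R by rewrite ler0n.
have hE : 8 * (M%:R + 1) * h = 1.
  by rewrite natr1 mulfV // gt_eqF // mulr_gt0 // ltr0n.
have re0 : 0 <= complex.Re w by apply: le_trans h1; rewrite !mulr_ge0 // ltW.
have re1 : complex.Re w <= 1 / 4.
  apply: le_trans h2 _.
  have e : 8 * (M%:R * h) + 8 * h = 1 by rewrite -[RHS]hE; ring.
  have le1 := ler_wpM2r (ltW h0) lM; rewrite -/h -mulrA.
  clear -e le1 h0; lra.
case: w h3 h4 re0 re1 {h1 h2} => a b /= b0 b1 a0 a1.
have -> : 5 / 16 = Num.sqrt ((5 / 16) ^+ 2) :> R.
  by rewrite sqrtr_sqr ger0_norm //; lra.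
by rewrite ler_wsqrtr //; nra.
Qed.

Lemma patch_separated M (l l' : 'I_M.+1) w w' : patch_cell l w -> patch_cell l' w' ->
  l != l' -> (8 * M.+1%:R)^-1 <= nrm (w - w').
Proof.
set h := (8 * M.+1%:R)^-1 : R; move=> [/andP[h1 h2] _] [/andP[h3 h4] _] ne.
have h0 : 0 < h by rewrite invr_gt0 mulr_gt0 // ltr0n.
have le1 := norm_Re_le (w - w').
have eRe : complex.Re (w - w') = complex.Re w - complex.Re w'.
  by case: w {h1 h2 le1} => ? ?; case: w' {h3 h4} => ? ?.
apply: le_trans le1; rewrite eRe {eRe}.
move: h1 h2 h3 h4; set x := complex.Re w; set y := complex.Re w'.
rewrite -!mulrA -/h => h1 h2 h3 h4.
have [ll|ll|/val_inj ll] := ltngtP l l'.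
- have : (l%:R + 1) * h <= l'%:R * h.
    by apply: ler_wpM2r; [exact: ltW|rewrite natr1 ler_nat].
  by rewrite mulrDl mul1r distrC ler_normr => le2; apply/orP; left; lra.
- have : (l'%:R + 1) * h <= l%:R * h.
    by apply: ler_wpM2r; [exact: ltW|rewrite natr1 ler_nat].
  by rewrite mulrDl mul1r ler_normr => le2; apply/orP; left; lra.
- by rewrite ll eqxx in ne.
Qed.

(** Otherwise every cell contains a point where [f] is small; these [M + 1] separated points and the
    interpolation bound force the coefficient sum to be at most half of itself, hence 0, against the
    strict inequality. *)
Lemma large_on_patch M : exists c : R, 0 < c /\
  forall f, (size f <= M.+1)%N -> exists l : 'I_M.+1, forall w, patch_cell l w ->
    c * (\sum_(k < M.+1) nrm f`_k) <= nrm f.[w].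
Proof.
have [|c [c0 hc]] := @interpolation_bound (8 * M.+1%:R)^-1 M.+1.
  by rewrite invr_gt0 mulr_gt0 // ltr0n.
exists (2 * c)^-1; split; first by rewrite invr_gt0 mulr_gt0.
move=> f sf; apply: contrapT => /forallNP no.
have ex (l : 'I_M.+1) : exists w, patch_cell l w /\
    nrm f.[w] < (2 * c)^-1 * (\sum_(k < M.+1) nrm f`_k).
  have /existsNP[w /not_implyP[pw /negP]] := no l.
  by rewrite -ltNge; exists w.
have [z hz] := choice ex; set S := \sum_(k < M.+1) nrm f`_k in hz.
have S0 : 0 <= S by apply: sumr_ge0 => k _; exact: nrm_ge0.
have m0 : 0 <= (2 * c)^-1 * S by rewrite mulr_ge0 // invr_ge0 mulr_ge0 // ltW.
have e : c * ((2 * c)^-1 * S) = S / 2 by field; rewrite gt_eqF.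
have := hc f z _ m0 sf; rewrite -/S e.
move=> hS; have : S <= S / 2.
  apply: hS => [i|i j ij|i].
  - by apply: le_trans (patch_nrm (hz i).1) _; lra.
  - exact: patch_separated (hz i).1 (hz j).1 ij.
  - exact: ltW (hz i).2.
move=> S2; have Sz : S = 0 by lra.
have := (hz ord0).2; rewrite Sz mulr0 => /lt_geF.
by rewrite nrm_ge0.
Qed.

End Interpolation.

(** * Scales and local sizes at the roots *)

Section Scales.
Local Open Scope classical_set_scope.
Variables (R : realType) (M N : nat).
Implicit Types (p q : {poly R[i]}) (a : 'I_N -> R[i]).

(* The scale [2] attached to the diagonal pairs stands for the size of the disk. *)
Definition scale a (i l : 'I_N) : R[i] := if l == i then 2 else a i - a l.

Definition taylor_size p a i l : R :=
  \sum_(nu < M.+1) nrm (p^`N(nu).[a i]) * nrm (scale a i l) ^+ nu.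

(** A sum in each factor instead of a maximum: comparable up to [2 ^ N], and visibly built from
    moduli of polynomials. *)
Definition root_product a i l : R :=
  \prod_(j < N) (nrm (scale a i l) + nrm (a i - a j)).

Definition admissible p q a (lc : R[i]) : Prop :=
  [/\ (size p <= M.+1)%N, q = lc *: \prod_(i < N) ('X - (a i)%:P),
      1 / 2 <= nrm lc <= 2, forall i, nrm (a i) <= 1 / 4 & injective a].

Lemma nrm2 : nrm (2 : R[i]) = 2.
Proof. exact: (nrm_nat R 2). Qed.

Lemma scale_gt0 a i l : injective a -> 0 < nrm (scale a i l).
Proof.
move=> ia; rewrite /scale; case: eqP => [_|/eqP li]; first by rewrite nrm2.
by rewrite nrm_gt0 subr_eq0 (inj_eq ia) eq_sym.
Qed.

Lemma scale_le2 a i l : (forall i, nrm (a i) <= 1 / 4) -> nrm (scale a i l) <= 2.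
Proof.
move=> ha; rewrite /scale; case: eqP => [_|_]; first by rewrite nrm2.
apply: le_trans (le_normcD _ _) _; rewrite normcN.
by have := ha i; have := ha l; lra.
Qed.

Lemma taylor_size_ge0 p a i l : 0 <= taylor_size p a i l.
Proof. by apply: sumr_ge0 => k _; rewrite mulr_ge0 ?exprn_ge0 ?nrm_ge0. Qed.

Lemma root_product_gt0 a i l : injective a -> 0 < root_product a i l.
Proof.
move=> ia; apply: prodr_gt0 => j _.
by rewrite ltr_pwDl ?scale_gt0 ?nrm_ge0.
Qed.

Definition scale_term (eps dl : R) p a i l : R :=
  taylor_size p a i l `^ eps * nrm (scale a i l) ^+ 2 /
  root_product a i l `^ dl.

Lemma scale_term_ge0 eps dl p a i l : 0 <= scale_term eps dl p a i l.
Proof. by rewrite divr_ge0 ?powR_ge0 // mulr_ge0 ?powR_ge0 ?sqr_ge0. Qed.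

Lemma taylor_expansion p (x z : R[i]) : (size p <= M.+1)%N ->
  p.[z] = \sum_(nu < M.+1) p^`N(nu).[x] * (z - x) ^+ nu.
Proof.
move=> sp; rewrite -(nderiv_taylor_wide _ sp); last exact: mulrC.
by rewrite addrC subrK.
Qed.

Lemma nrm_horner_roots q a lc (z : R[i]) :
  q = lc *: \prod_(i < N) ('X - (a i)%:P) ->
  nrm q.[z] = nrm lc * \prod_(j < N) nrm (z - a j).
Proof.
move=> ->; rewrite hornerZ Normc.normcM horner_prod nrm_prod.
by congr (_ * _); apply: eq_bigr => j _; rewrite !hornerE.
Qed.

End Scales.

Section NullSets.
Local Open Scope classical_set_scope.
Variable R : realType.
Notation mu := (@lebC R).

Definition zero_set (q : {poly R[i]}) : set (R * R) := [set z | q.[cplx z] = 0].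

Lemma measurable_zero_set q : measurable (zero_set q).
Proof.
have -> : zero_set q =
    setT `&` (fun z : R * R => nrm q.[cplx z]) @^-1` [set 0].
  rewrite setTI; apply/seteqP; split => z /=; first by move=> ->; exact: Normc.normc0.
  by move/Normc.eq0_normc.
exact: measurable_nrm_horner.
Qed.

(** The squares of side 0 centred at the roots cover the zero set. *)
Lemma lebC_zero_set N (a : 'I_N -> R[i]) lc q :
  lc != 0 -> q = lc *: \prod_(i < N) ('X - (a i)%:P) -> mu (zero_set q) = 0%E.
Proof.
move=> lc0 qE.
pose U := \big[setU/set0]_(i < N) csquare (a i) 0.
have [mU U0] : measurable U /\ mu U = 0%E.
  rewrite /U; elim/big_ind: _ => [|A B [mA A0] [mB B0]|i _].
  - by split; [exact: measurable0|exact: measure0].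
  - split; first exact: measurableU.
    by rewrite -A0; exact: measureU0.
  - by split; [exact: measurable_box|rewrite /csquare lebC_box ?mulr0].
have sub : zero_set q `<=` U.
  move=> z; rewrite /zero_set /= qE hornerZ => /eqP; rewrite mulf_eq0 (negPf lc0) /=.
  rewrite horner_prod => /eqP/eqP /prodf_eq0[i _]; rewrite !hornerE => /eqP zi.
  by rewrite /U (bigD1 i) //=; left; apply: csquare_mem; rewrite zi Normc.normc0.
apply/eqP; rewrite eq_le measure_ge0 andbT -U0.
by apply: le_measure => //; rewrite inE //; exact: measurable_zero_set.
Qed.

End NullSets.

Section LowerBound.
Local Open Scope classical_set_scope.
Variables (R : realType) (M N : nat) (eps dl : R).
Hypotheses (eps0 : 0 <= eps) (dl0 : 0 <= dl).
Notation mu := (@lebC R).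

Definition integrand (p q : {poly R[i]}) (z : R * R) : R :=
  nrm p.[cplx z] `^ eps / nrm q.[cplx z] `^ dl.

Lemma integrand_ge0 p q z : 0 <= integrand p q z.
Proof. by rewrite divr_ge0 ?powR_ge0. Qed.

(* At a root of [q] the quotient takes the junk value [0] when [dl > 0], so
   lower bounds for the integrand only hold off the zero set. *)
Lemma integral_remove_zero_set (p q : {poly R[i]}) (D : set (R * R)) :
  measurable D -> mu (zero_set q) = 0%E ->
  (\int[mu]_(z in D) (integrand p q z)%:E =
   \int[mu]_(z in D `\` zero_set q) (integrand p q z)%:E)%E.
Proof.
move=> mD h; rewrite -ge0_negligible_integral //.
- exact: measurable_zero_set.
- by apply: measurable_funTS; exact: measurable_integrand.
- by move=> z _; rewrite lee_fin integrand_ge0.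
Qed.

(** In the coordinate [w = (z - a i) / s], the coefficients of [p] have total modulus [taylor_size],
    so some cell satisfies [|p| >= c A] throughout. There [|q| <= 2 B] because [|w| <= 1], and the
    cell has area [s ^ 2] times a constant. *)
Lemma integral_lower_bound : exists c : R, 0 < c /\
  forall p q a lc, admissible M p q a lc -> forall i l : 'I_N,
    ((c * scale_term M eps dl p a i l)%:E <=
     \int[mu]_(z in @unit_disk R) (integrand p q z)%:E)%E.
Proof.
have [c [c0 hc]] := @large_on_patch R M.
pose h : R := (8 * M.+1%:R)^-1.
have h0 : 0 < h by rewrite invr_gt0 mulr_gt0 // ltr0n.
exists (c `^ eps / 2 `^ dl * (h / 16)); split.
  by rewrite !mulr_gt0 ?invr_gt0 ?powR_gt0.
move=> p q a lc [sp qE /andP[lc1 lc2] ha ia] i l.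
pose s : R := nrm (scale a i l); set A := taylor_size M p a i l.
set B := root_product a i l.
have s0 : 0 < s by exact: scale_gt0.
have s2 : s <= 2 by exact: scale_le2.
have B0 : 0 < B by exact: root_product_gt0.
have lc0 : lc != 0 by rewrite -nrm_gt0; apply: lt_le_trans lc1; lra.
pose f : {poly R[i]} := \poly_(nu < M.+1) (p^`N(nu).[a i] * (s%:C)%C ^+ nu).
have nrms : nrm (s%:C)%C = s.
  by rewrite /= expr0n addr0 sqrtr_sqr gtr0_norm.
have [|k hk] := hc f; first exact: size_poly.
have fA : \sum_(nu < M.+1) nrm f`_nu = A.
  apply: eq_bigr => nu _; rewrite coef_poly ltn_ord Normc.normcM nrmX.
  by rewrite nrms.
(* The image of cell [k] under [w -> a i + s w], of area [s ^ 2 h / 16]. *)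
pose D := box (complex.Re (a i) + s * (2 * k%:R * h)) (complex.Im (a i)) (s * h) (s / 16).
have mD : measurable D by exact: measurable_box.
have Dpatch z : D z -> exists w, patch_cell k w /\ cplx z = a i + (s%:C)%C * w.
  case: z => u v [/=]; rewrite !in_itv /= => /andP[u1 u2] /andP[v1 v2].
  exists (Complex ((u - complex.Re (a i)) / s) ((v - complex.Im (a i)) / s)).
  split; last first.
    case: (a i) => x y; rewrite /cplx /=; apply/eqP.
    rewrite eq_complex /=; have sn : s != 0 by rewrite gt_eqF.
    by apply/andP; split; apply/eqP; field.
  rewrite /patch_cell /= -/h; split; apply/andP; split.
  - by rewrite ler_pdivlMr // lerBrDl mulrC.
  - by rewrite ler_pdivrMr // lerBlDl mulrDl !(mulrC _ s) addrA.
  - by rewrite divr_ge0 ?(ltW s0) // subr_ge0.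
  - rewrite ler_pdivrMr //; lra.
(* The image stays within radius [1/4 + 2 * 5/16 = 7/8]. *)
have Ddisk : D `<=` @unit_disk R.
  move=> z /Dpatch[w [pw zE]].
  have : nrm (cplx z) < 1.
    rewrite zE; apply: le_lt_trans (le_normcD _ _) _.
    rewrite Normc.normcM nrms; have := ha i; have := patch_nrm pw.
    have := nrm_ge0 w; move: (nrm w) (nrm (a i)) => x y; nra.
  case: z {zE} => u v /= ; rewrite /unit_disk /= => lt1.
  by rewrite -(ltr_sqrt _ ltr01) sqrtr1.
have lbd z : (D `\` zero_set q) z ->
    (c * A) `^ eps / (2 * B) `^ dl <= integrand p q z.
  move=> [/Dpatch[w [pw zE]] qz].
  have q0 : 0 < nrm q.[cplx z] by rewrite nrm_gt0; apply/eqP.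
  have wle : nrm w <= 1 by apply: le_trans (patch_nrm pw) _; lra.
  have pz : p.[cplx z] = f.[w].
    rewrite (taylor_expansion (a i) _ sp) horner_poly; apply: eq_bigr => nu _.
    by rewrite zE addrC addKr exprMn mulrA.
  apply: ler_pM; rewrite ?powR_ge0 ?invr_ge0 ?powR_ge0 //.
    apply: ge0_ler_powR; rewrite ?nnegrE ?nrm_ge0 ?mulr_ge0 ?taylor_size_ge0 ?(ltW c0) //.
    by rewrite pz -fA; exact: hk.
  rewrite lef_pV2 ?posrE ?powR_gt0 ?mulr_gt0 //.
  apply: ge0_ler_powR; rewrite ?nnegrE ?nrm_ge0 ?mulr_ge0 ?(ltW B0) //.
  rewrite (nrm_horner_roots _ qE); apply: ler_pM => //; rewrite ?nrm_ge0 //.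
    by apply: prodr_ge0 => j _; exact: nrm_ge0.
  apply: ler_prod => j _; rewrite nrm_ge0 /=.
  have -> : cplx z - a j = (s%:C)%C * w + (a i - a j) by rewrite zE; ring.
  apply: le_trans (le_normcD _ _) _; rewrite lerD2r Normc.normcM nrms.
  by rewrite ler_piMr // ltW.
have null := lebC_zero_set lc0 qE.
have mint E : measurable_fun E (fun z => (integrand p q z)%:E).
  by apply: measurable_funTS; exact: measurable_integrand.
have mZ := measurable_zero_set q.
have le1 : (\int[mu]_(z in D) (integrand p q z)%:E <=
            \int[mu]_(z in @unit_disk R) (integrand p q z)%:E)%E.
  apply: ge0_subset_integral;
    [exact: mD|exact: measurable_unit_disk|exact: mint| |exact: Ddisk].
  by move=> z _; rewrite lee_fin integrand_ge0.
apply: le_trans le1.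
rewrite (integral_remove_zero_set p mD null).
apply: le_trans (_ : \int[mu]_(z in D `\` zero_set q)
    ((c * A) `^ eps / (2 * B) `^ dl)%:E <= _)%E; last first.
  apply: ge0_le_integral; [exact: measurableD| |exact: measurable_cst|exact: mint|].
  - by move=> z _; rewrite lee_fin divr_ge0 ?powR_ge0.
  - by move=> z Dz; rewrite lee_fin; exact: lbd.
rewrite -ge0_negligible_integral //; last first.
  by move=> z _; rewrite lee_fin divr_ge0 ?powR_ge0.
have muD : mu D = (s * h * (s / 16))%:E.
  by rewrite lebC_box // ?mulr_ge0 ?divr_ge0 // ltW.
rewrite integral_cst // [X in (_ * X)%E](_ : _ = (s * h * (s / 16))%:E); last exact: muD.
rewrite -EFinM lee_fin le_eqVlt; apply/orP; left; apply/eqP.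
rewrite /scale_term -/s -/A -/B !powRM ?taylor_size_ge0 ?(ltW c0) ?(ltW B0) // invfM.
by ring.
Qed.

End LowerBound.

(** * The upper bound *)

Section NearestScale.
Local Open Scope classical_set_scope.
Variables (R : realType) (N : nat) (d : 'I_N -> R) (i : 'I_N) (r : R).
Hypotheses (d0 : forall j, 0 <= d j) (di : d i = 0).
Hypotheses (dpos : forall j, j != i -> 0 < d j) (r0 : 0 < r) (r2 : r <= 2).

Definition dist_scale l : R := if l == i then 2 else d l.

Definition nclose : nat := #|[pred j | d j <= r]|.

Lemma nclose_gt0 : (0 < nclose)%N.
Proof. by apply/card_gt0P; exists i; rewrite inE di ltW. Qed.

Lemma nclose_le : (nclose <= N)%N.
Proof. by rewrite -[X in (_ <= X)%N]card_ord max_card. Qed.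

Lemma dist_scale_gt0 l : 0 < dist_scale l.
Proof. by rewrite /dist_scale; case: eqP => [//|/eqP /dpos]. Qed.

(** No root distance is crossed between [r] and [s], so both radii have the same close roots in
    every maximum [max r (d j)]. *)
Definition same_side s := forall j, (d j <= r -> d j <= s) /\ (r < d j -> s <= d j).

(** The least distance beyond [r], or the scale 2 when there is none. *)
Lemma scale_above : exists l, r <= dist_scale l /\ same_side (dist_scale l).
Proof.
have [/existsP[j0 hj0]|no] := boolP [exists j, r < d j].
  have [l hl hmin] := @arg_minP _ _ _ j0 (fun j => r < d j) d hj0.
  have li : l != i by apply: contraTneq hl => ->; rewrite di -leNgt ltW.
  exists l; rewrite /dist_scale (negPf li); split; first exact: ltW.
  move=> j; split => [dj|]; last exact: hmin.
  by apply: le_trans dj _; exact: ltW.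
exists i; rewrite /dist_scale eqxx; split => // j; split => h; first exact: le_trans r2.
by move/negP: no; case; apply/existsP; exists j.
Qed.

(** The largest distance up to [r] from a root other than [i]; it exists once a second root is
    close. *)
Lemma scale_below : (1 < nclose)%N ->
  exists l, dist_scale l <= r /\ same_side (dist_scale l).
Proof.
move=> n1; have [j0 hj0 j0i] : exists2 j, d j <= r & j != i.
  have [/existsP[j /andP[h1 h2]]|no] := boolP [exists j, (d j <= r) && (j != i)].
    by exists j.
  move: n1; rewrite ltnNge => /negP; case.
  rewrite -(card1 i) subset_leq_card //; apply/fintype.subsetP => j; rewrite !inE => dj.
  by apply: contraNT no => ji; apply/existsP; exists j; rewrite dj.
have hP : (d j0 <= r) && (j0 != i) by rewrite hj0.
have [l /andP[hl li] hmax] := @arg_maxP _ _ _ j0 (fun j => (d j <= r) && (j != i)) d hP.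
exists l; rewrite /dist_scale (negPf li); split => // j; split => h; last first.
  by apply: le_trans hl _; exact: ltW.
have [->|ji] := eqVneq j i; first by rewrite di.
by apply: hmax; rewrite h.
Qed.

Lemma prod_max_rescale s : 0 < s -> same_side s ->
  \prod_j Num.max r (d j) = (r / s) ^+ nclose * \prod_j Num.max s (d j).
Proof.
move=> s0 ss; rewrite /nclose -prodr_const [X in X * _]big_mkcond /= -big_split /=.
apply: eq_bigr => j _; have [h1 h2] := ss j; rewrite inE.
case: (leP (d j) r) => h.
  by rewrite max_l ?h1 // divfK // gt_eqF.
by rewrite mul1r max_r ?h2.
Qed.

End NearestScale.

Section RadialBound.
Local Open Scope classical_set_scope.
Variables (R : realType) (M N : nat) (eps dl : R).
Hypotheses (eps0 : 0 <= eps) (dl0 : 0 <= dl) (dl2 : dl < 2).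

Definition radial_exponent (nu k : nat) : R := nu%:R * eps - k%:R * dl.

(* Between two consecutive scales the radial weight is an exact power of the radius,
   so it is controlled by its value at the endpoint selected by the sign of the
   exponent plus two. *)
Lemma radial_bound (F : 'I_M.+1 -> R) (d : 'I_N -> R) (i : 'I_N) (r : R) :
  (forall nu, 0 <= F nu) -> (forall j, 0 <= d j) -> d i = 0 ->
  (forall j, j != i -> 0 < d j) -> 0 < r -> r <= 2 ->
  exists (l : 'I_N) (nu : 'I_M.+1) (k : 'I_N.+1),
    [/\ (0 < k)%N, reaches (radial_exponent nu k) (r / dist_scale d i l) &
    (\sum_(nu < M.+1) F nu * r ^+ nu) `^ eps / (\prod_j Num.max r (d j)) `^ dl <=
    M.+1%:R `^ eps *
    ((\sum_(nu < M.+1) F nu * dist_scale d i l ^+ nu) `^ eps /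
     (\prod_j Num.max (dist_scale d i l) (d j)) `^ dl) *
    (r / dist_scale d i l) `^ radial_exponent nu k].
Proof.
move=> F0 d0 di dpos r0 r2.
(* The exponent comes from the dominant Taylor term at radius [r]; the whole sum is at most [M + 1]
   times it. *)
have [nu _ hnu] := @arg_maxP _ _ _ (ord0 : 'I_M.+1) xpredT (fun nu => F nu * r ^+ nu) isT.
pose k := nclose d r.
have k1 : (0 < k)%N by exact: (nclose_gt0 di r0).
have kN : (k < N.+1)%N by rewrite ltnS nclose_le.
have [l [hl ss]] : exists l, reaches (radial_exponent nu k) (r / dist_scale d i l) /\
    same_side d r (dist_scale d i l).
  rewrite /reaches; case: ltP => hs.
    have [l [hl ss]] := scale_above di r0 r2; exists l; split => //.
    by rewrite ler_pdivrMr ?mul1r // dist_scale_gt0.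
  (* In this branch the exponent is at most [-2]. For [k = 1] it would be at least [- dl > -2], so a
     second root is close and a scale below [r] exists. *)
  have k2 : (1 < k)%N.
    rewrite ltn_neqAle k1 andbT; apply/eqP => k1'.
    move: hs; rewrite -k1' /radial_exponent.
    have : 0 <= nu%:R * eps by rewrite mulr_ge0.
    rewrite mul1r => h1; rewrite leNgt => /negP; apply.
    by apply: (@lt_le_trans _ _ (- dl)); rewrite ?ltrN2 ?lerDr.
  have [l [hl ss]] := scale_below d0 di k2; exists l; split => //.
  by rewrite ler_pdivlMr ?mul1r // dist_scale_gt0.
exists l, nu, (Ordinal kN); split => //=.
have s0 := dist_scale_gt0 dpos l; move: (dist_scale d i l) hl ss s0 => s hl ss s0.
set x := r / s; have x0 : 0 < x by rewrite divr_gt0.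
have rE : r = x * s by rewrite divfK // gt_eqF.
rewrite (prod_max_rescale s0 ss) -/k -/x; clearbody x.
set D := \prod_j Num.max s (d j); set As := \sum_(nu < M.+1) F nu * s ^+ nu.
have D0 : 0 < D by apply: prodr_gt0 => j _; rewrite lt_max s0.
have As0 : 0 <= As by apply: sumr_ge0 => j _; rewrite mulr_ge0 // exprn_ge0 // ltW.
have leA : \sum_(nu < M.+1) F nu * r ^+ nu <= M.+1%:R * As * x ^+ nu.
  apply: le_trans (_ : \sum_(j < M.+1) F nu * r ^+ nu <= _).
    by apply: ler_sum => j _; exact: hnu.
  rewrite sumr_const card_ord -[leLHS]mulr_natl -[leRHS]mulrA.
  apply: ler_wpM2l => //.
  rewrite [leRHS]mulrC {1}rE exprMn mulrCA ler_wpM2l ?exprn_ge0 ?(ltW x0) //.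
  rewrite /As (bigD1 nu) //= lerDl; apply: sumr_ge0 => j _.
  by rewrite mulr_ge0 // exprn_ge0 // ltW.
have A0 : 0 <= \sum_(nu < M.+1) F nu * r ^+ nu.
  by apply: sumr_ge0 => j _; rewrite mulr_ge0 // exprn_ge0 // ltW.
have xk n : (x ^+ n) `^ dl = x `^ (n%:R * dl) by rewrite powRrM powR_mulrn // ltW.
have xn n : (x ^+ n) `^ eps = x `^ (n%:R * eps) by rewrite powRrM powR_mulrn // ltW.
rewrite /radial_exponent powRB; last by apply/implyP => _; rewrite gt_eqF.
rewrite powRM ?exprn_ge0 ?(ltW x0) ?(ltW D0) // xk invfM.
apply: le_trans (_ : (M.+1%:R * As * x ^+ nu) `^ eps *
                     ((x `^ (k%:R * dl))^-1 * (D `^ dl)^-1) <= _).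
  rewrite ler_wpM2r ?mulr_ge0 ?invr_ge0 ?powR_ge0 //.
  by apply: ge0_ler_powR; rewrite ?nnegrE ?mulr_ge0 ?exprn_ge0 ?(ltW x0).
rewrite !powRM ?mulr_ge0 ?exprn_ge0 ?(ltW x0) // xn.
by rewrite le_eqVlt; apply/orP; left; apply/eqP; ring.
Qed.

End RadialBound.

Section UpperBound.
Local Open Scope classical_set_scope.
Variables (R : realType) (M N : nat) (eps dl : R).
Hypotheses (eps0 : 0 <= eps) (dl0 : 0 <= dl) (dl2 : dl < 2) (N0 : (0 < N)%N).
Hypothesis nonresonant : forall nu k : nat, (nu <= M)%N -> (0 < k <= N)%N ->
  radial_exponent eps dl nu k + 2 != 0.
Notation mu := (@lebC R).

Definition weight p a i l : R :=
  taylor_size M p a i l `^ eps / @root_product R N a i l `^ dl.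

Lemma weight_ge0 p a i l : 0 <= weight p a i l.
Proof. by rewrite divr_ge0 ?powR_ge0. Qed.

(** With [i] the nearest root, [|z - a j|] is at least half of both [r] and [|a i - a j|]. The
    constant collects 2 from the leading coefficient, [2 ^ N] from these halves and [2 ^ N] from
    replacing maxima by the sums in [root_product]. *)
Lemma integrand_pointwise p q a lc (z : R * R) :
  admissible M p q a lc -> @unit_disk R z -> ~ zero_set q z ->
  exists (i l : 'I_N) (nu : 'I_M.+1) (k : 'I_N.+1),
   [/\ (0 < k)%N, 0 < nrm (cplx z - a i),
    reaches (radial_exponent eps dl nu k) (nrm (cplx z - a i) / nrm (scale a i l)) &
    integrand eps dl p q z <= M.+1%:R `^ eps * (2 * 2 ^+ N * 2 ^+ N) `^ dl *
      weight p a i l *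
      (nrm (cplx z - a i) / nrm (scale a i l)) `^ radial_exponent eps dl nu k].
Proof.
move=> [sp qE /andP[lc1 lc2] ha ia] zB qz.
have [i _ hmin] := @arg_minP _ _ _ (Ordinal N0) xpredT (fun j => nrm (cplx z - a j)) isT.
pose r := nrm (cplx z - a i).
have z1 : nrm (cplx z) <= 1.
  move: zB; rewrite /unit_disk /=; case: (z) => u v /= h.
  by rewrite -[leRHS]sqrtr1 ler_wsqrtr // ltW.
have q0 : 0 < nrm q.[cplx z] by rewrite nrm_gt0; apply/eqP.
have r0 : 0 < r.
  rewrite nrm_gt0; apply: contraPneq q0 => zi; rewrite (nrm_horner_roots _ qE).
  by rewrite (bigD1 i) //= zi Normc.normc0 mul0r mulr0 ltxx.
have r2 : r <= 2.
  apply: le_trans (le_normcD _ _) _; rewrite normcN.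
  by apply: le_trans (lerD z1 (ha i)) _; lra.
pose d j := nrm (a i - a j).
have di : d i = 0 by rewrite /d subrr Normc.normc0.
have dpos j : j != i -> 0 < d j.
  by move=> ji; rewrite nrm_gt0 subr_eq0 (inj_eq ia) eq_sym.
pose F (nu : 'I_M.+1) := nrm (p^`N(nu).[a i]).
have [l [nu [k [k0 hreach hle]]]] := radial_bound eps0 dl2
  (fun nu => nrm_ge0 _ : 0 <= F nu) (fun j => nrm_ge0 _ : 0 <= d j) di dpos r0 r2.
have scE : dist_scale d i l = nrm (scale a i l).
  by rewrite /dist_scale /scale; case: eqP => // _; rewrite nrm2.
rewrite scE in hreach hle.
exists i, l, nu, k; split => //.
apply: le_trans (_ : (2 * 2 ^+ N) `^ dl *
  ((\sum_(nu < M.+1) F nu * r ^+ nu) `^ eps / (\prod_j Num.max r (d j)) `^ dl) <= _).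
  rewrite mulrCA; apply: ler_pM; rewrite ?powR_ge0 ?invr_ge0 ?powR_ge0 //.
    apply: ge0_ler_powR; rewrite ?nnegrE ?nrm_ge0 //.
      by apply: sumr_ge0 => j _; rewrite mulr_ge0 ?exprn_ge0 ?nrm_ge0.
    rewrite (taylor_expansion (a i) _ sp); apply: le_trans (nrm_sum _ _ _) _.
    by apply: ler_sum => j _; rewrite Normc.normcM nrmX.
  have P0 : 0 < \prod_j Num.max r (d j) by apply: prodr_gt0 => j _; rewrite lt_max r0.
  rewrite ler_pdivlMr ?powR_gt0 // mulrC ler_pdivrMr ?powR_gt0 // -powRM ?nrm_ge0 //.
  apply: ge0_ler_powR; rewrite ?nnegrE ?mulr_ge0 ?nrm_ge0 ?(ltW P0) //.
  rewrite (nrm_horner_roots _ qE).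
  have -> : 2 * 2 ^+ N * (nrm lc * \prod_(j < N) nrm (cplx z - a j)) =
            (2 * nrm lc) * \prod_(j < N) (2 * nrm (cplx z - a j)).
    by rewrite big_split /= prodr_const card_ord; ring.
  rewrite -[leLHS]mul1r; apply: ler_pM; rewrite ?(ltW P0) //; first lra.
  apply: ler_prod => j _; rewrite le_max (ltW r0) /= ge_max.
  have := hmin j isT; rewrite -/r => hj; apply/andP; split.
    by rewrite mulr_natl mulr2n; apply: le_trans hj _; rewrite lerDl nrm_ge0.
  apply: le_trans (nrm_triangle (cplx z) _ _) _.
  by rewrite [nrm (a i - _)]nrmB -/r mulr_natl mulr2n lerD2r.
apply: le_trans (ler_wpM2l (powR_ge0 _ _) hle) _.
rewrite [leLHS]mulrA; apply: ler_wpM2r; first exact: powR_ge0.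
rewrite [leLHS]mulrCA -[leRHS]mulrA; apply: ler_wpM2l; first exact: powR_ge0.
rewrite /weight [leLHS]mulrCA [leRHS]mulrCA; apply: ler_wpM2l; first exact: powR_ge0.
have B0 := root_product_gt0 i l ia.
have s0 := scale_gt0 i l ia.
have P0 : 0 < \prod_j Num.max (nrm (scale a i l)) (d j).
  by apply: prodr_gt0 => j _; rewrite lt_max s0.
rewrite [(_ * 2 ^+ N * 2 ^+ N) `^ _]powRM ?mulr_ge0 ?exprn_ge0 // -[leRHS]mulrA.
apply: ler_wpM2l; first exact: powR_ge0.
rewrite ler_pdivlMr ?powR_gt0 // mulrC ler_pdivrMr ?powR_gt0 //.
rewrite -powRM ?exprn_ge0 ?(ltW P0) //.
apply: ge0_ler_powR; rewrite ?nnegrE ?mulr_ge0 ?exprn_ge0 ?(ltW P0) ?(ltW B0) //.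
rewrite -[X in _ ^+ X]card_ord -prodr_const -big_split /=.
apply: ler_prod => j _; rewrite addr_ge0 ?nrm_ge0 //=.
rewrite mulr_natl mulr2n; apply: lerD; rewrite le_max ?lexx ?orbT //.
Qed.

(** The disk is not cut into regions: the majorants for all data [(i, l, nu, k)] are added. At each
    point off the zero set one of them bounds the integrand, and each integrates to at most a
    constant times a [scale_term]. *)
Lemma integral_upper_bound : exists C : R, 0 < C /\
  forall p q a lc, admissible M p q a lc ->
    (\int[mu]_(z in @unit_disk R) (integrand eps dl p q z)%:E <=
     (C * \sum_(i < N) \sum_(l < N) scale_term M eps dl p a i l)%:E)%E.
Proof.
pose C0 : R := M.+1%:R `^ eps * (2 * 2 ^+ N * 2 ^+ N) `^ dl.
have C00 : 0 <= C0 by rewrite mulr_ge0 ?powR_ge0.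
pose G (nu : 'I_M.+1) (k : 'I_N.+1) : R := let sg := radial_exponent eps dl nu k in
  2 `^ `|sg| * (4 / (1 - dyad sg `^ (sg + 2))).
pose J := ('I_N * 'I_N * ('I_M.+1 * 'I_N.+1))%type.
(* The value [k = 0] is left out: a root is always counted among its own close roots, and
   nonresonance is assumed only for [k >= 1]. *)
pose ok (x : J) := (0 < x.2.2)%N.
pose H p a (x : J) (z : R * R) : \bar R :=
  ((C0 * weight p a x.1.1 x.1.2 * 2 `^ `|radial_exponent eps dl x.2.1 x.2.2|)%:E *
   majorant (radial_exponent eps dl x.2.1 x.2.2) (a x.1.1)
     (nrm (scale a x.1.1 x.1.2)) z)%E.
have nr (x : J) : ok x -> radial_exponent eps dl x.2.1 x.2.2 + 2 != 0.
  move=> kx; apply: nonresonant; first by rewrite -ltnS.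
  by apply/andP; split; [exact: kx|rewrite -ltnS].
have G0 (x : J) : ok x -> 0 <= G x.2.1 x.2.2.
  move=> kx; rewrite /G mulr_ge0 ?powR_ge0 // divr_ge0 // subr_ge0 ltW //.
  by apply: dyad_lt1; exact: nr.
pose S := \sum_(y : 'I_M.+1 * 'I_N.+1 | (0 < y.2)%N) G y.1 y.2.
have S0 : 0 <= S.
  by apply: sumr_ge0 => y ky; exact: (G0 ((Ordinal N0, Ordinal N0), y)).
(* [C0 * S] is only known to be nonnegative; adding 1 makes the constant positive. *)
exists (C0 * S + 1); split; first by rewrite ltr_wpDl // mulr_ge0.
move=> p q a lc adm; have [sp qE /andP[lc1 lc2] ha ia] := adm.
have lc0 : lc != 0 by rewrite -nrm_gt0; apply: lt_le_trans lc1; lra.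
have null := lebC_zero_set lc0 qE.
have mB := @measurable_unit_disk R.
have mZ := measurable_zero_set q.
have H0 x z : (0 <= H p a x z)%E.
  apply: mule_ge0; last exact: majorant_ge0.
  by rewrite lee_fin mulr_ge0 ?powR_ge0 // mulr_ge0 // weight_ge0.
have mH x D : measurable D -> measurable_fun D (H p a x).
  by move=> mD; apply: measurable_funeM; exact: measurable_majorant.
rewrite (integral_remove_zero_set eps dl p mB null).
have mBZ : measurable (@unit_disk R `\` zero_set q) by exact: measurableD.
apply: le_trans (_ : \int[mu]_(z in @unit_disk R `\` zero_set q)
   (\sum_(x <- enum [pred x | ok x]) H p a x z) <= _)%E.
  apply: ge0_le_integral; [exact: mBZ| | | |].
  - by move=> z _; rewrite lee_fin integrand_ge0.
  - by apply: measurable_funTS; exact: measurable_integrand.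
  - by apply: emeasurable_sum => x; exact: mH.
  move=> z [zB qz].
  have [i [l [nu [k [k0 r0 hr hle]]]]] := integrand_pointwise adm zB qz.
  pose x : J := ((i, l), (nu, k)).
  apply: le_trans (_ : H p a x z <= _)%E; last first.
    have xin : x \in enum [pred x | ok x] by rewrite mem_enum.
    rewrite (big_rem x) //= leeDl //; apply: sume_ge0 => y _; exact: H0.
  apply: le_trans (_ : ((C0 * weight p a i l) *
     (nrm (cplx z - a i) / nrm (scale a i l)) `^ radial_exponent eps dl nu k)%:E <= _)%E.
    by rewrite lee_fin.
  have cw0 : (0 <= (C0 * weight p a i l)%:E)%E by rewrite lee_fin mulr_ge0 // weight_ge0.
  have := lee_wpmul2l cw0 (powR_le_majorant (scale_gt0 i l ia) r0 hr).
  by rewrite muleA -!EFinM.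
rewrite ge0_integral_sum //; last 1 first.
- by move=> x; exact: mH.
apply: le_trans (_ : \sum_(x <- enum [pred x | ok x])
   (C0 * G x.2.1 x.2.2 * scale_term M eps dl p a x.1.1 x.1.2)%:E <= _)%E.
  rewrite big_seq [leRHS]big_seq; apply: lee_sum => x; rewrite mem_enum inE => okx.
  have w0 : 0 <= C0 * weight p a x.1.1 x.1.2 *
      2 `^ `|radial_exponent eps dl x.2.1 x.2.2|.
    by rewrite mulr_ge0 ?powR_ge0 // mulr_ge0 // weight_ge0.
  rewrite /H ge0_integralZl_EFin //; last 2 first.
  - by move=> z _; exact: majorant_ge0.
  - exact: measurable_majorant.
  have s0 := scale_gt0 x.1.1 x.1.2 ia.
  have := integral_majorant_le (a x.1.1) mBZ s0 (nr x okx).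
  move=> /(lee_wpmul2l (_ : 0 <= (C0 * weight p a x.1.1 x.1.2 *
      2 `^ `|radial_exponent eps dl x.2.1 x.2.2|)%:E)%E); rewrite lee_fin => /(_ w0).
  move/le_trans; apply; rewrite -EFinM lee_fin /G /scale_term /weight.
  by rewrite le_eqVlt; apply/orP; left; apply/eqP; ring.
rewrite sumEFin lee_fin big_enum /=.
rewrite (eq_bigl (fun x : J => xpredT x.1 && (0 < x.2.2)%N)) //.
rewrite -(pair_big xpredT (fun y : 'I_M.+1 * 'I_N.+1 => (0 < y.2)%N)
  (fun w y => C0 * G y.1 y.2 * scale_term M eps dl p a w.1 w.2)) /=.
rewrite [X in _ <= _ * X]pair_big /=.
set T := \sum_(w : 'I_N * 'I_N) scale_term M eps dl p a w.1 w.2.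
have T0 : 0 <= T.
  by apply: sumr_ge0 => w _; exact: scale_term_ge0.
have -> : \sum_(w : 'I_N * 'I_N) \sum_(y : 'I_M.+1 * 'I_N.+1 | (0 < y.2)%N)
   C0 * G y.1 y.2 * scale_term M eps dl p a w.1 w.2 = C0 * S * T.
  rewrite /T mulr_sumr; apply: eq_bigr => w _.
  by rewrite /S mulr_sumr -mulr_suml.
by rewrite ler_wpM2r // lerDl.
Qed.

End UpperBound.

(** * Combination *)

Section Coefficients.
Variable R : rcfType.

Lemma coef_coefpoly m (b : 'I_m -> R[i]) (j : 'I_m) : (coefpoly b)`_j = b j.
Proof.
have e : (if (j < m)%N =P true is ReflectT h then b (Ordinal h) else 0) = b j.
  by case: eqP => [h|]; [congr b; apply: val_inj|rewrite ltn_ord].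
by rewrite coef_poly e ltn_ord.
Qed.

Lemma size_coefpoly m (b : 'I_m -> R[i]) : (size (coefpoly b) <= m)%N.
Proof. exact: size_poly. Qed.

Lemma coefpolyE m (b : 'I_m -> R[i]) : coefpoly b = \sum_(j < m) b j *: 'X^j.
Proof.
rewrite {1}/coefpoly poly_def; apply: eq_bigr => j _.
by case: eqP => [h|]; [congr (b _ *: _); apply: val_inj|rewrite ltn_ord].
Qed.

Lemma nrm_coef_le_tnorm (p : {poly R[i]}) k : nrm p`_k <= tnorm p.
Proof.
have s0 : forall P : pred 'I_(size p), 0 <= \sum_(i < size p | P i) nrm p`_i.
  by move=> P; apply: sumr_ge0 => i _; exact: nrm_ge0.
have [kp|kp] := ltnP k (size p); last first.
  by rewrite nth_default // Normc.normc0; exact: s0.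
by rewrite /tnorm (bigD1 (Ordinal kp)) //= lerDl; exact: s0.
Qed.

(** At a root, [|z| ^ N = |(q - X^N)(z)| <= t max(1, |z| ^ N)]. Since [t < 1], the maximum must be
    1, whence [|z| ^ N <= t < (1 / 4) ^ N]. *)
Lemma nrm_root_le (q : {poly R[i]}) N z : (0 < N)%N -> (size q <= N.+1)%N ->
  tnorm (q - 'X^N) < (1 / 4) ^+ N -> root q z -> nrm z <= 1 / 4.
Proof.
move=> N0 sq tq /rootP qz; rewrite leNgt; apply/negP => zlt.
set t := tnorm _ in tq.
have z0 : 0 < nrm z by apply: lt_trans zlt; lra.
have t0 : 0 <= t by apply: sumr_ge0 => i _; exact: nrm_ge0.
have t1 : t < 1.
  apply: lt_le_trans tq _; apply: exprn_ile1; lra.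
have sz : (size (q - 'X^N)%R <= N.+1)%N.
  apply: leq_trans (size_polyD _ _) _.
  by rewrite size_polyN size_polyXn geq_max sq leqnn.
pose Mx := Num.max 1 (nrm z ^+ N).
have le1 : nrm z ^+ N <= t * Mx.
  rewrite -nrmX -(normcN (z ^+ N)).
  have -> : - z ^+ N = (q - 'X^N).[z] by rewrite !hornerE qz sub0r.
  rewrite horner_coef; apply: le_trans (nrm_sum _ _ _) _.
  rewrite /t /tnorm mulr_suml; apply: ler_sum => i _.
  rewrite Normc.normcM nrmX ler_wpM2l ?nrm_ge0 // le_max.
  have iN : (i <= N)%N by rewrite -ltnS; apply: leq_trans sz.
  have [z1|z1] := leP (nrm z) 1.
    by rewrite exprn_ile1 ?nrm_ge0.
  by rewrite ler_weXn2l ?orbT // ltW.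
have [z1|z1] := leP 1 (nrm z ^+ N).
  by move: le1; rewrite /Mx max_r // ler_pMl ?exprn_gt0 // leNgt t1.
move: le1; rewrite /Mx max_l ?(ltW z1) // mulr1 leNgt => /negP; apply.
apply: lt_trans tq _; have q0 : 0 <= 1 / 4 :> R by lra.
by rewrite ltrXn2r ?nnegrE ?nrm_ge0 // -lt0n.
Qed.

End Coefficients.

(** * The roots of a polynomial near [Z^N] *)

Section Roots.
Variables (R : realType) (M N : nat).
Hypothesis N0 : (0 < N)%N.

Lemma admissible_roots (b1 : 'I_M.+1 -> R[i]) (b2 : 'I_N.+1 -> R[i]) :
  tnorm (coefpoly b2 - 'X^N) < (1 / 4) ^+ N -> simple_roots (coefpoly b2) ->
  exists a : 'I_N -> R[i],
    admissible M (coefpoly b1) (coefpoly b2) a (b2 ord_max) /\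
    forall j : 'I_N, b2 (widen_ord (leqnSn N) j) / b2 ord_max =
                     (\prod_(i < N) ('X - (a i)%:P))`_j.
Proof.
set q := coefpoly b2 => tq sr.
have sq : (size q <= N.+1)%N by exact: size_coefpoly.
have lt1 : nrm (b2 ord_max - 1) < 1 / 4.
  have -> : b2 ord_max - 1 = (q - 'X^N)`_N.
    by rewrite coefB coefXn eqxx -(coef_coefpoly b2 ord_max).
  apply: le_lt_trans (nrm_coef_le_tnorm _ _) _; apply: lt_le_trans tq _.
  by rewrite -[leRHS]expr1 ler_wiXn2l //; lra.
have lo : 1 / 2 <= nrm (b2 ord_max).
  have := le_normcD (b2 ord_max) (1 - b2 ord_max).
  by rewrite addrC subrK Normc.normc1 nrmB; lra.
have up : nrm (b2 ord_max) <= 2.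
  have := le_normcD (b2 ord_max - 1) 1.
  by rewrite subrK Normc.normc1; lra.
have b0 : b2 ord_max != 0 by rewrite -nrm_gt0; lra.
have qN : q`_N = b2 ord_max by rewrite -(coef_coefpoly b2 ord_max).
have sqE : size q = N.+1.
  apply/eqP; rewrite eqn_leq sq ltnNge; apply/negP => h.
  by move: b0; rewrite -qN nth_default ?eqxx.
have lq : lead_coef q = b2 ord_max by rewrite lead_coefE sqE.
have q0 : q != 0 by rewrite -lead_coef_eq0 lq.
have [r qr] := closed_field_poly_normal q; rewrite lq in qr.
have sr' : size r = N.
  by have := sqE; rewrite qr size_scale // size_prod_XsubC => -[].
(* Multiplicity as a root equals the number of occurrences in [r], so simple roots make [r]
   duplicate-free and [a] injective. *)
have ur : uniq r.
  apply: count_mem_uniq => x; rewrite -mu_prod_XsubC.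
  have rx : root q x = (x \in r) by rewrite qr rootZ // root_prod_XsubC.
  have mE : mup x (\prod_(z <- r) ('X - z%:P)) = mup x q.
    by rewrite qr -mul_polyC mupMr // rootC.
  rewrite mE; case: (boolP (x \in r)) => xr; first by rewrite sr // rx.
  by rewrite mupNroot // rx.
pose a (i : 'I_N) := r`_i.
have prodE : \prod_(z <- r) ('X - z%:P) = \prod_(i < N) ('X - (a i)%:P).
  by rewrite (big_nth 0) sr' big_mkord.
exists a; split; first split.
- exact: size_coefpoly.
- by rewrite -prodE.
- by rewrite lo up.
- move=> i; apply: (nrm_root_le N0 sq tq).
  by rewrite qr rootZ // root_prod_XsubC mem_nth // sr'.
- move=> i j /eqP; rewrite nth_uniq ?sr' // => /eqP; exact: val_inj.
move=> j; rewrite -prodE; have -> : b2 (widen_ord (leqnSn N) j) = q`_j.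
  by rewrite -(coef_coefpoly b2).
by rewrite qr coefZ mulrC mulKf.
Qed.

End Roots.

Section PowerSums.
Variable R : realType.

Lemma sum_pow_le (J : finType) (t : J -> R) m (x0 : J) : (forall x, 0 <= t x) ->
  (\sum_x t x) ^+ m <= #|J|%:R ^+ m * \sum_x t x ^+ m.
Proof.
move=> t0; have [x _ hmax] := @arg_maxP _ _ _ x0 xpredT t isT.
apply: le_trans (_ : (#|J|%:R * t x) ^+ m <= _).
  rewrite lerXn2r ?nnegrE ?mulr_ge0 ?sumr_ge0 //.
  rewrite mulr_natl -sumr_const; apply: ler_sum => y _; exact: hmax.
rewrite exprMn ler_wpM2l ?exprn_ge0 // (bigD1 x) //= lerDl.
by apply: sumr_ge0 => y _; rewrite exprn_ge0.
Qed.

Lemma pow_sum_le (J : finType) (t : J -> R) m : (forall x, 0 <= t x) ->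
  \sum_x t x ^+ m <= #|J|%:R * (\sum_x t x) ^+ m.
Proof.
move=> t0; rewrite mulr_natl -sumr_const; apply: ler_sum => y _.
rewrite lerXn2r ?nnegrE ?sumr_ge0 // (bigD1 y) //= lerDl.
by apply: sumr_ge0 => x _.
Qed.

(** [ka] has the form [eps' / 2] of the exponent in an ARP, and [2 h ka = 1 / m]. *)
Lemma powR_root_equiv (c C X E : R) h m : (0 < h)%N -> (0 < m)%N ->
  0 < c -> 0 < C -> 0 <= X ->
  c * X ^+ (2 * h) <= E -> E <= C * X ^+ (2 * h) ->
  let ka := (h * m)%:R^-1 / 2 in
  c `^ ka * X `^ m%:R^-1 <= E `^ ka /\ E `^ ka <= C `^ ka * X `^ m%:R^-1.
Proof.
move=> h0 m0 c0 C0 X0 lo up ka.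
have ka0 : 0 <= ka by rewrite divr_ge0 // invr_ge0.
have E0 : 0 <= E by apply: le_trans lo; rewrite mulr_ge0 ?exprn_ge0 // ltW.
have e : X `^ m%:R^-1 = (X ^+ (2 * h)) `^ ka.
  rewrite -powR_mulrn // -powRrM; congr (_ `^ _); rewrite /ka !natrM invfM.
  by field; rewrite !pnatr_eq0 -!lt0n h0 m0.
rewrite e -!powRM ?exprn_ge0 ?(ltW c0) ?(ltW C0) //.
by split; apply: ge0_ler_powR; rewrite ?nnegrE ?mulr_ge0 ?exprn_ge0 ?(ltW c0) ?(ltW C0).
Qed.

End PowerSums.

(** Provides one power [m] that turns both exponents into integers. *)
Lemma rat_common_denominator (x y : rat) : 0 <= x -> 0 <= y ->
  exists m p q : nat, [/\ (0 < m)%N, x = p%:R / m%:R & y = q%:R / m%:R].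
Proof.
have frac (z : rat) : 0 <= z ->
    exists n d : nat, (0 < d)%N /\ z = n%:R / d%:R.
  move=> z0; exists `|numq z|%N, `|denq z|%N.
  rewrite absz_gt0 denq_eq0; split => //.
  rewrite -[LHS]divq_num_den -[in LHS](gez0_abs (_ : 0 <= numq z)) ?numq_ge0 //.
  by rewrite -[in LHS](gez0_abs (_ : 0 <= denq z)) ?denq_ge0 // !pmulrn.
move=> /frac[n1 [d1 [d10 ->]]] /frac[n2 [d2 [d20 ->]]].
exists (d1 * d2)%N, (n1 * d2)%N, (n2 * d1)%N; rewrite muln_gt0 d10 d20 !natrM.
by split => //; field; rewrite !pnatr_eq0 -!lt0n d10 d20.
Qed.

Section Combination.
Variables (R : realType) (M N m pn qn : nat).
Hypotheses (N0 : (0 < N)%N) (m0 : (0 < m)%N).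
Let J := ('I_N * 'I_N)%type.
Let eps : R := pn%:R / m%:R.
Let dl : R := qn%:R / m%:R.
Hypothesis dl2 : dl < 2.
Hypothesis nonresonant : forall nu k : nat, (nu <= M)%N -> (0 < k <= N)%N ->
  radial_exponent eps dl nu k + 2 != 0.
Notation mu := (@lebC R).

Definition denominator (a : 'I_N -> R[i]) : R :=
  \prod_(x : J) root_product a x.1 x.2 ^+ qn.

Definition numerator p (a : 'I_N -> R[i]) : R :=
  \sum_(x : J) taylor_size M p a x.1 x.2 ^+ pn * nrm (scale a x.1 x.2) ^+ (2 * m) *
    \prod_(y : J | y != x) root_product a y.1 y.2 ^+ qn.

Lemma denominator_gt0 a : injective a -> 0 < denominator a.
Proof.
by move=> ia; apply: prodr_gt0 => x _; rewrite exprn_gt0 // root_product_gt0.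
Qed.

Lemma scale_term_pow p a i l : injective a ->
  scale_term M eps dl p a i l ^+ m =
  taylor_size M p a i l ^+ pn * nrm (scale a i l) ^+ (2 * m) /
  @root_product R N a i l ^+ qn.
Proof.
move=> ia; have mn : m%:R != 0 :> R by rewrite pnatr_eq0 -lt0n.
have e (X : R) k : 0 <= X -> (X `^ (k%:R / m%:R)) ^+ m = X ^+ k.
  by move=> X0; rewrite -powR_mulrn ?powR_ge0 // -powRrM divfK // powR_mulrn.
rewrite /scale_term expr_div_n exprMn e ?taylor_size_ge0 // e -?exprM //.
exact/ltW/root_product_gt0.
Qed.

Lemma numeratorE p a : injective a ->
  numerator p a = denominator a * \sum_(x : J) scale_term M eps dl p a x.1 x.2 ^+ m.
Proof.
move=> ia; rewrite mulr_sumr; apply: eq_bigr => x _.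
rewrite scale_term_pow // /denominator [X in _ = X * _](bigD1 x) //=.
have B0 : root_product a x.1 x.2 ^+ qn != 0.
  by rewrite gt_eqF // exprn_gt0 // root_product_gt0.
move: B0; set B := root_product a x.1 x.2 ^+ qn; set u := _ * _ ^+ (2 * m).
set P := \prod_(_ | _) _; move: B u P => B u P B0.
by field.
Qed.

(** The upper bound makes the integral a real [v]. It is comparable to the sum of the [scale_term]s,
    because the lower bound holds for each pair separately; for finitely many terms the [m]-th power
    of the sum is comparable to the sum of [m]-th powers, which is numerator over denominator. *)
Lemma integral_pow_equiv : exists c C : R, [/\ 0 < c, 0 < C &
  forall p q a lc, admissible M p q a lc -> exists v : R,
    [/\ (\int[mu]_(z in @unit_disk R) (integrand eps dl p q z)%:E = v%:E)%E,
        0 <= v,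
        c * (v ^+ m * denominator a) <= numerator p a &
        numerator p a <= C * (v ^+ m * denominator a)]].
Proof.
have eps0 : 0 <= eps by rewrite divr_ge0.
have dl0 : 0 <= dl by rewrite divr_ge0.
have [c0 [c00 hlo]] := @integral_lower_bound R M N eps dl eps0 dl0.
have [C0 [C00 hup]] := @integral_upper_bound R M N eps dl eps0 dl0 dl2 N0 nonresonant.
pose n : R := #|{: J}|%:R.
have n0 : 0 < n by rewrite ltr0n; apply/card_gt0P; exists (Ordinal N0, Ordinal N0).
exists ((n * C0) ^+ m)^-1, (n * (n / c0) ^+ m).
split; rewrite ?invr_gt0 ?mulr_gt0 ?exprn_gt0 ?mulr_gt0 ?invr_gt0 //.
move=> p q a lc adm; have ia : injective a by case: adm.
pose t (x : J) := scale_term M eps dl p a x.1 x.2.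
have t0 x : 0 <= t x by exact: scale_term_ge0.
have lo x := hlo p q a lc adm x.1 x.2.
have := hup p q a lc adm; rewrite pair_big /= -/(t _) => up.
set I := (\int[mu]_(z in _) _)%E in lo up *.
have I0 : (0 <= I)%E.
  by apply: integral_ge0 => z _; rewrite lee_fin integrand_ge0.
have Ifin : I \is a fin_num.
  by rewrite ge0_fin_numE //; apply: le_lt_trans up _; rewrite ltry.
move: Ifin I0 lo up; case: I => // v _; rewrite lee_fin => v0 lo.
rewrite lee_fin => up; exists v; split => //.
  rewrite numeratorE // [leRHS]mulrC mulrA ler_pM2r ?denominator_gt0 //.
  rewrite ler_pdivrMl ?exprn_gt0 ?mulr_gt0 //.
  apply: le_trans (_ : C0 ^+ m * (\sum_x t x) ^+ m <= _).
    by rewrite -exprMn lerXn2r ?nnegrE ?mulr_ge0 ?sumr_ge0 ?(ltW C00).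
  rewrite exprMn -mulrA mulrCA ler_pM2l ?exprn_gt0 //.
  by apply: sum_pow_le => //; exact: (Ordinal N0, Ordinal N0).
rewrite numeratorE // [leLHS]mulrC [leRHS]mulrA ler_pM2r ?denominator_gt0 //.
apply: le_trans (pow_sum_le m t0) _; rewrite -mulrA ler_pM2l // -exprMn.
rewrite lerXn2r ?nnegrE ?sumr_ge0 //.
  by rewrite mulr_ge0 // divr_ge0 // ltW.
rewrite mulrAC ler_pdivlMr // mulr_suml /n mulr_natl -sumr_const.
apply: ler_sum => x _; rewrite mulrC -lee_fin; exact: lo.
Qed.

Lemma admissible_perm (p q : {poly R[i]}) a lc (s : 'S_N) :
  admissible M p q a lc -> admissible M p q (a \o s) lc.
Proof.
move=> [h1 h2 h3 h4 h5]; split => //.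
- by rewrite h2 (reindex_inj (@perm_inj _ s)).
- by move=> i; exact: h4.
- by move=> i j /h5; exact: perm_inj.
Qed.

(** The divided derivative has integer binomial coefficients. For [k < nu] the truncated exponent
    [k - nu] is harmless because the binomial coefficient vanishes. *)
Lemma ipf_nderivn nu (i : 'I_N) :
  int_poly_fun (fun (b : 'I_M.+1 -> R[i]) a => (coefpoly b)^`N(nu).[a i]).
Proof.
have [e he] : int_poly_fun (fun (b : 'I_M.+1 -> R[i]) (a : 'I_N -> R[i]) =>
    \sum_(k < M.+1) b k * (a i ^+ (k - nu) * (('C(k, nu) : int)%:~R))).
  apply: ipf_sum => k; apply: ipf_mul; first exact: ipf_b.
  by apply: ipf_mul; [apply: ipf_exp; exact: ipf_a|exact: ipf_int].
exists e => b a; rewrite he coefpolyE linear_sum horner_sum /=.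
apply: eq_bigr => k _; rewrite nderivnZ hornerZ nderivnXn hornerMn hornerXn.
by rewrite -pmulrn mulr_natr.
Qed.

Lemma ipf_scale i l :
  int_poly_fun (fun (_ : 'I_M.+1 -> R[i]) (a : 'I_N -> R[i]) => scale a i l).
Proof.
rewrite /scale; case: eqP => _; first exact: (ipf_int _ _ _ 2).
by apply: ipf_sub; exact: ipf_a.
Qed.

Lemma abss_root_product i l : abs_summable
  (fun (_ : 'I_M.+1 -> R[i]) (a : 'I_N -> R[i]) => root_product a i l).
Proof.
apply: abss_prod => j; apply: abss_add; apply: abss_nrm; first exact: ipf_scale.
by apply: ipf_sub; exact: ipf_a.
Qed.

Lemma abss_denominator : abs_summable
  (fun (_ : 'I_M.+1 -> R[i]) (a : 'I_N -> R[i]) => denominator a).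
Proof. by apply: abss_prod => x; apply: abss_exp; exact: abss_root_product. Qed.

Lemma abss_numerator : abs_summable
  (fun (b : 'I_M.+1 -> R[i]) (a : 'I_N -> R[i]) => numerator (coefpoly b) a).
Proof.
apply: abss_sum => x; apply: abss_mul; last first.
  by apply: abss_prod => y; apply: abss_exp; exact: abss_root_product.
apply: abss_mul; apply: abss_exp; last by apply: abss_nrm; exact: ipf_scale.
apply: abss_sum => nu; apply: abss_mul; first by apply: abss_nrm; exact: ipf_nderivn.
by apply: abss_exp; apply: abss_nrm; exact: ipf_scale.
Qed.

(** The divided derivative of order [deg p] is the leading coefficient. *)
Lemma taylor_size_gt0 (p : {poly R[i]}) (a : 'I_N -> R[i]) i l :
  injective a -> p != 0 -> (size p <= M.+1)%N ->
  0 < taylor_size M p a i l :> R.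
Proof.
move=> ia p0 sp; have s0 := scale_gt0 i l ia; pose nu := (size p).-1.
have nuM : (nu < M.+1)%N by rewrite /nu prednK ?size_poly_gt0.
rewrite /taylor_size (bigD1 (Ordinal nuM)) //= ltr_pwDl //.
  rewrite mulr_gt0 ?exprn_gt0 // nrm_gt0.
  have -> : p^`N(nu) = (lead_coef p)%:P.
    apply/polyP => k; rewrite coef_nderivn coefC; case: k => [|k].
      by rewrite addn0 binn mulr1n.
    by rewrite nth_default ?mul0rn // /nu addnS -addSn prednK ?size_poly_gt0 // leq_addr.
  by rewrite hornerC lead_coef_eq0.
by apply: sumr_ge0 => j _; rewrite mulr_ge0 ?exprn_ge0 ?nrm_ge0.
Qed.

Lemma numerator_gt0 (p : {poly R[i]}) (a : 'I_N -> R[i]) :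
  injective a -> p != 0 -> (size p <= M.+1)%N ->
  0 < numerator p a.
Proof.
move=> ia p0 sp; pose x0 : J := (Ordinal N0, Ordinal N0).
have pos (x : J) : 0 < taylor_size M p a x.1 x.2 ^+ pn *
    nrm (scale a x.1 x.2) ^+ (2 * m) *
    \prod_(y : J | y != x) root_product a y.1 y.2 ^+ qn.
  rewrite !mulr_gt0 ?exprn_gt0 ?taylor_size_gt0 ?scale_gt0 //.
  by apply: prodr_gt0 => y _; rewrite exprn_gt0 // root_product_gt0.
rewrite /numerator (bigD1 x0) //=; apply: ltr_pwDl; first exact: (pos x0).
by apply: sumr_ge0 => x _; exact/ltW/pos.
Qed.

End Combination.

(** * From the roots to an ARP in the coefficients *)

Section ARPConstruction.
Variables (R : realType) (M N m pn qn : nat).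
Hypotheses (N0 : (0 < N)%N) (m0 : (0 < m)%N).
Let eps : R := pn%:R / m%:R.
Let dl : R := qn%:R / m%:R.
Hypothesis dl2 : dl < 2.
Hypothesis nonresonant : forall nu k : nat, (nu <= M)%N -> (0 < k <= N)%N ->
  radial_exponent eps dl nu k + 2 != 0.
Notation mu := (@lebC R).

Definition valid (b1 : 'I_M.+1 -> R[i]) (b2 : 'I_N.+1 -> R[i]) : Prop :=
  [/\ exists j, b1 j != 0, tnorm (coefpoly b2 - 'X^N) < (1 / 4) ^+ N &
      simple_roots (coefpoly b2)].

Definition sq_sum (ps : seq (intpoly (M.+1 + N.+1))) b1 b2 : R :=
  \sum_(p <- ps) nrm (ipeval p (@bcat R[i] M.+1 N.+1 b1 b2)) ^+ 2.

(** A zero member makes the family nonempty, as its passage to coefficients requires. *)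
Lemma abs_summable_pad f : @abs_summable R M.+1 N f ->
  exists s, (0 < size s)%N /\ forall b a, abs_sum s b a = f b a.
Proof.
move=> [s hs]; exists (PInt 0 :: s); split => // b a.
have e : peval b a (PInt 0) = 0 by [].
by rewrite /abs_sum big_cons e Normc.normc0 add0r; exact: hs.
Qed.

(** [K] and [L] are comparable to the [m]-th roots of the symmetrized numerator [NS] and denominator
    [DS]. Since [NS ~ v ^ m DS], their quotient is comparable to [v]. Both are positive because the
    identity ordering already contributes a positive term. *)
Lemma integral_sq_sum_equiv :
  exists (ps qs : seq (intpoly (M.+1 + N.+1))) (h h' : nat) (c C : R),
  [/\ (0 < h)%N, (0 < h')%N, 0 < c, 0 < C & forall b1 b2, valid b1 b2 ->
    let K := sq_sum ps b1 b2 `^ ((h * m)%:R^-1 / 2) in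
    let L := sq_sum qs b1 b2 `^ ((h' * m)%:R^-1 / 2) in
    let I := (\int[mu]_(z in @unit_disk R)
               (integrand eps dl (coefpoly b1) (coefpoly b2) z)%:E)%E in
    [/\ 0 < K, 0 < L, ((c * (K / L))%:E <= I)%E & (I <= (C * (K / L))%:E)%E]].
Proof.
have [c1 [C1 [c10 C10 hI]]] := integral_pow_equiv N0 m0 dl2 nonresonant.
have [sN [sN0 hN]] := abs_summable_pad (abss_numerator R M N m pn qn).
have [sD [sD0 hD]] := abs_summable_pad (abss_denominator R M N qn).
have [ps [h [cN [CN [h0 cN0 CN0 hps]]]]] := sym_abs_sum_equiv R sN0.
have [qs [h' [cD [CD [h'0 cD0 CD0 hqs]]]]] := sym_abs_sum_equiv R sD0.
pose k : R := (h * m)%:R^-1 / 2; pose k' : R := (h' * m)%:R^-1 / 2.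
pose mi : R := m%:R^-1.
exists ps, qs, h, h'.
(* The lower constant joins the upper bounds for [K] and [NS] with the lower bound for [L]; the
   upper constant joins the opposite three. *)
exists ((CN `^ k * C1 `^ mi)^-1 * cD `^ k'), ((cN `^ k * c1 `^ mi)^-1 * CD `^ k').
split => //; try by rewrite !mulr_gt0 ?invr_gt0 ?mulr_gt0 ?powR_gt0.
move=> b1 b2 [[j bj] tq sr] /=.
have [a [adm ha]] := admissible_roots N0 b1 tq sr.
have [sp qE lcb hroot ia] := adm.
have p0 : coefpoly b1 != 0.
  by apply: contraNneq bj => p0; rewrite -(coef_coefpoly b1) p0 coef0.
have [lN uN] := hps b1 b2 a lcb ha; have [lD uD] := hqs b1 b2 a lcb ha.
rewrite -/(sq_sum ps b1 b2) in lN uN; rewrite -/(sq_sum qs b1 b2) in lD uD.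
have [v [vE v0 _ _]] := hI _ _ _ _ adm; rewrite vE !lee_fin.
set NS := sym_abs_sum sN b1 a in lN uN; set DS := sym_abs_sum sD b1 a in lD uD.
have perm_inj_a (s : 'S_N) : injective (a \o s) by move=> x y /ia; exact: perm_inj.
have DS0 : 0 < DS.
  rewrite /DS /sym_abs_sum (bigD1 1%g) //= ltr_pwDl //.
    by rewrite hD; apply: denominator_gt0; exact: perm_inj_a.
  by apply: sumr_ge0 => s _; exact: abs_sum_ge0.
have NS0 : 0 < NS.
  rewrite /NS /sym_abs_sum (bigD1 1%g) //= ltr_pwDl //.
    by rewrite hN; apply: numerator_gt0 => //; exact: perm_inj_a.
  by apply: sumr_ge0 => s _; exact: abs_sum_ge0.
(* The estimate holds for every ordering of the roots with the same value [v],
   so it can be summed over all permutations. *)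
have hs (s : 'S_N) : c1 * (v ^+ m * abs_sum sD b1 (a \o s)) <= abs_sum sN b1 (a \o s) /\
    abs_sum sN b1 (a \o s) <= C1 * (v ^+ m * abs_sum sD b1 (a \o s)).
  have [w [wE w0 lo up]] := hI _ _ _ _ (admissible_perm s adm).
  have wv : w = v by apply/EFin_inj; rewrite -wE -vE.
  by rewrite hD hN -wv.
have lNS : c1 * (v ^+ m * DS) <= NS.
  by rewrite /NS /DS /sym_abs_sum !mulr_sumr; apply: ler_sum => s _; exact: (hs s).1.
have uNS : NS <= C1 * (v ^+ m * DS).
  by rewrite /NS /DS /sym_abs_sum !mulr_sumr; apply: ler_sum => s _; exact: (hs s).2.
have [lK uK] := powR_root_equiv h0 m0 cN0 CN0 (ltW NS0) lN uN.
have [lL uL] := powR_root_equiv h'0 m0 cD0 CD0 (ltW DS0) lD uD.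
rewrite -/k -/k' -/mi in lK uK lL uL *.
have mi0 : 0 <= mi by rewrite invr_ge0.
have vm : (v ^+ m) `^ mi = v.
  by rewrite -powR_mulrn // -powRrM mulfV ?powRr1 // pnatr_eq0 -lt0n.
have vDS0 : 0 <= v ^+ m * DS by rewrite mulr_ge0 ?exprn_ge0 // ltW.
have lNS' : c1 `^ mi * (v * DS `^ mi) <= NS `^ mi.
  rewrite -{1}vm -powRM ?exprn_ge0 // ?(ltW DS0) // -powRM ?(ltW c10) //.
  by apply: ge0_ler_powR;
    rewrite ?nnegrE ?mulr_ge0 ?exprn_ge0 ?(ltW DS0) ?(ltW c10) ?(ltW NS0).
have uNS' : NS `^ mi <= C1 `^ mi * (v * DS `^ mi).
  rewrite -{1}vm -powRM ?exprn_ge0 // ?(ltW DS0) // -powRM ?(ltW C10) //.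
  by apply: ge0_ler_powR;
    rewrite ?nnegrE ?mulr_ge0 ?exprn_ge0 ?(ltW DS0) ?(ltW C10) ?(ltW NS0).
have K0 : 0 < sq_sum ps b1 b2 `^ k.
  by apply: lt_le_trans lK; rewrite mulr_gt0 ?powR_gt0.
have L0 : 0 < sq_sum qs b1 b2 `^ k'.
  by apply: lt_le_trans lL; rewrite mulr_gt0 ?powR_gt0.
move: (sq_sum ps b1 b2 `^ k) (sq_sum qs b1 b2 `^ k') K0 L0 lK uK lL uL.
move=> K L K0 L0 lK uK lL uL.
have gN : 0 < CN `^ k by rewrite powR_gt0.
have gN' : 0 < cN `^ k by rewrite powR_gt0.
have g1 : 0 < c1 `^ mi by rewrite powR_gt0.
have g1' : 0 < C1 `^ mi by rewrite powR_gt0.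
split => //.
  rewrite mulrA ler_pdivrMr // -mulrA ler_pdivrMl ?mulr_gt0 //.
  apply: le_trans (_ : cD `^ k' * (CN `^ k * (C1 `^ mi * (v * DS `^ mi))) <= _).
    rewrite ler_wpM2l ?powR_ge0 //; apply: le_trans uK _.
    by rewrite ler_wpM2l ?powR_ge0.
  have -> : cD `^ k' * (CN `^ k * (C1 `^ mi * (v * DS `^ mi))) =
            CN `^ k * C1 `^ mi * v * (cD `^ k' * DS `^ mi) by ring.
  by rewrite [leRHS]mulrA ler_wpM2l // !mulr_ge0 ?powR_ge0.
rewrite mulrA ler_pdivlMr // -mulrA ler_pdivlMl ?mulr_gt0 //.
apply: le_trans (_ : CD `^ k' * (cN `^ k * (c1 `^ mi * (v * DS `^ mi))) <= _).
  have -> : CD `^ k' * (cN `^ k * (c1 `^ mi * (v * DS `^ mi))) =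
            cN `^ k * c1 `^ mi * v * (CD `^ k' * DS `^ mi) by ring.
  by rewrite [leLHS]mulrA ler_wpM2l // !mulr_ge0 ?powR_ge0.
rewrite ler_wpM2l ?powR_ge0 //; apply: le_trans lK.
by rewrite ler_wpM2l ?powR_ge0.
Qed.

End ARPConstruction.

Unset Implicit Arguments.

Theorem theorem5 (R : realType) (eps delta : rat) (M N : nat) :
  0 <= eps -> 0 <= delta -> delta < 2 -> (0 < N)%N ->
  (forall nu k : nat, (nu <= M)%N -> (k < N)%N ->
     nu%:R * eps - (N - k)%:R * delta + 2 != 0 :> rat) ->
  exists (T : ARP (M.+1 + N.+1)) (s1 : R), 0 < s1 < 1 /\
  exists c C : R, 0 < c /\ 0 < C /\
  forall (b1 : 'I_M.+1 -> R[i]) (b2 : 'I_N.+1 -> R[i]),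
    (exists j, b1 j != 0) ->
    tnorm (coefpoly b2 - 'X^N) < s1 ->
    simple_roots (coefpoly b2) ->
    arp_strict_dom T (bcat b1 b2) /\
    let I := (\int[@lebC R]_(p in @unit_disk R)
               (powR (Normc.normc (coefpoly b1).[cplx p]) (ratr eps) /
                powR (Normc.normc (coefpoly b2).[cplx p]) (ratr delta))%:E)%E in
    ((c * arp_eval T (bcat b1 b2))%:E <= I /\
     I <= (C * arp_eval T (bcat b1 b2))%:E)%E.
Proof.
move=> eps0 delta0 delta2 N0 nonres.
have [m [pn [qn [m0 epsE deltaE]]]] := rat_common_denominator eps0 delta0.
have epsR : ratr eps = pn%:R / m%:R :> R by rewrite epsE fmorph_div /= !ratr_nat.
have dlR : ratr delta = qn%:R / m%:R :> R by rewrite deltaE fmorph_div /= !ratr_nat.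
have dl2 : qn%:R / m%:R < 2 :> R by rewrite -dlR -(ratr_nat R 2) ltr_rat.
have nonresR nu k : (nu <= M)%N -> (0 < k <= N)%N ->
    radial_exponent (pn%:R / m%:R : R) (qn%:R / m%:R) nu k + 2 != 0.
  move=> nuM /andP[k0 kN].
  (* The hypothesis counts by complement: it is used at [N - k], where [k] is the number of close
     roots. *)
  have kN' : (N - k < N)%N by rewrite ltn_subrL k0 N0.
  have := nonres nu _ nuM kN'; rewrite subKn //; apply: contraNneq => h.
  rewrite -(fmorph_eq0 (@ratr R)) -[X in _ == X]h rmorphD rmorphB !rmorphM /=.
  by rewrite !ratr_nat epsR dlR.
have [ps [qs [h [h' [c [C [h0 h'0 c0 C0 hmain]]]]]]] :=
  integral_sq_sum_equiv N0 m0 dl2 nonresR.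
have s1 : 0 < ((1 / 4) ^+ N : R) < 1.
  apply/andP; split; first by rewrite exprn_gt0.
  by rewrite exprn_ilt1 -?lt0n //; lra.
(* The numerator of the ARP is not the zero polynomial because it does not
   vanish at some valid [b]; if there is no such [b], any ARP will do. *)
have [[b1 [b2 hb]]|no] := pselect (exists b1 b2, @valid R M N b1 b2); last first.
  have one_nz : exists2 p, p \in [:: ip_const (M.+1 + N.+1) 1] & ~~ ip_is_zero p.
    exists (ip_const _ 1); first exact: mem_head.
    apply/negP => /(@ipeval_zero _ R _ (fun=> 0)).
    by rewrite ipeval_const => /eqP; rewrite oner_eq0.
  exists (@MkARP _ [:: ip_const _ 1] [::] 0 0 (lexx _) (lexx _) one_nz), ((1 / 4) ^+ N).
  split => //; exists 1, 1; split => //; split => // b1 b2 hb1 hb2 hb3.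
  by case: no; exists b1, b2.
have nz : exists2 p, p \in ps & ~~ ip_is_zero p.
  apply: contrapT => all0; have [K0 _ _ _] := hmain b1 b2 hb.
  have S0 : sq_sum ps b1 b2 = 0.
    rewrite /sq_sum big_seq big1 // => p pps.
    have [pz|pz] := boolP (ip_is_zero p); last by case: all0; exists p.
    by rewrite ipeval_zero // Normc.normc0 expr0n.
  move: K0; rewrite S0 powR0 ?ltxx // gt_eqF // divr_gt0 // invr_gt0 ltr0n muln_gt0.
  by rewrite h0.
have invR n : ratr n%:R^-1 = n%:R^-1 :> R by rewrite fmorphV /= ratr_nat.
have e0 : 0 <= (h * m)%:R^-1 :> rat by rewrite invr_ge0.
have d0 : 0 <= (h' * m)%:R^-1 :> rat by rewrite invr_ge0.
(* The exponents are [eps' = 1 / (h m)] and [delta' = 1 / (h' m)]; the halving is part of [arp_K]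
   and [arp_L]. *)
exists (MkARP qs e0 d0 nz), ((1 / 4) ^+ N); split => //.
exists c, C; split => //; split => // b1' b2' hb1 hb2 hb3.
have := hmain b1' b2' (And3 hb1 hb2 hb3).
rewrite /arp_strict_dom /arp_eval /arp_K /arp_L /= !invR epsR dlR.
by move=> [K0 L0 lo up]; split; first by rewrite !gt_eqF.
Qed.
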